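(* Let $R$ be a commutative Noetherian ring (not necessarily local) and let $I$ be an ideal of $R$ of positive height. Assume that $R$ satisfies Serre's condition $(S_2)$. Then the following conditions are equivalent: (i) $I$ is integrally closed and $[I]\in\mathrm{Pic}\,R$. (ii) $R_{\mathfrak{p}}$ is a discrete valuation ring for every $\mathfrak{p}\in\mathrm{Ass}_R(R/I)$, and $[I]\in\mathrm{Pic}\,R$. (iii) $I$ is integrally closed and $I\otimes_R I^{\ast}$ is reflexive. Moreover, if one of these equivalent conditions holds, then a primary decomposition of $I$ is of the form $$I=\bigcap_{\mathfrak{p}\in\mathrm{Ass}_R(R/I)}\mathfrak{p}^{(n(\mathfrak{p}))},$$ where $n(\mathfrak{p})\ge 1$ for every $\mathfrak{p}\in\mathrm{Ass}_R(R/I)$ and $\mathfrak{p}^{(n(\mathfrak{p}))}$ denotes a symbolic power of $\mathfrak{p}$.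
   Context: For an $R$-module $M$, $M^{\ast}=\mathrm{Hom}_R(M,R)$, and $M$ is reflexive if the natural map $M\to M^{\ast\ast}$ is an isomorphism. $R$ satisfies Serre's condition $(S_n)$ if $\mathrm{depth}\,R_{\mathfrak{p}}\ge\min\{n,\dim R_{\mathfrak{p}}\}$ for all $\mathfrak{p}\in\mathrm{Spec}(R)$. $\mathrm{Pic}\,R$ consists of the isomorphism classes $[M]$ of finitely generated projective $R$-modules $M$ such that $M_{\mathfrak{p}}\cong R_{\mathfrak{p}}$ for all $\mathfrak{p}\in\mathrm{Spec}(R)$; $[I]\in\mathrm{Pic}\,R$ means that $I$ is such a module. The symbolic power $\mathfrak{p}^{(n)}$ is the preimage of $\mathfrak{p}^nR_{\mathfrak{p}}$ under $R\to R_{\mathfrak{p}}$. *)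

(* Defs.v *)
From HB Require Import structures.
From mathcomp Require Import all_boot all_order all_algebra.
From mathcomp Require Import boolp classical_sets functions cardinality.
From mathcomp Require Import constructive_ereal ring.

Set Implicit Arguments.
Unset Strict Implicit.
Unset Printing Implicit Defensive.

Import Order.TTheory GRing.Theory Num.Theory.
Local Open Scope classical_set_scope.
Local Open Scope quotient_scope.
Local Open Scope ring_scope.

(* Rings are [comPzRingType]s, so the zero ring is allowed. Submodules are the
   library's [submodClosed M]: Boolean predicates closed under the operations.
   As [boolp] makes every proposition decidable, these are all the submodules.
   An ideal is a submodule of [R^o]; it may be the whole ring. *)
Notation ideal R := (submodClosed R^o).

Section Span.
Context {R : comPzRingType} {M : lmodType R}.
Implicit Types X : set M.

Definition span X : {pred M} :=
  fun x => `[< forall N : submodClosed M, (forall y, X y -> y \in N) -> x \in N >].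

Lemma span_submod_closed X : submod_closed (span X).
Proof.
split=> [|a x y /asboolP xX /asboolP yX]; apply/asboolP => N XN.
  exact: rpred0.
by apply: rpredD; [apply/rpredZ/xX|exact: yX].
Qed.

HB.instance Definition _ X :=
  GRing.isSubmodClosed.Build R M (span X) (span_submod_closed X).
End Span.

Definition submodule_type (R : comPzRingType) (M : lmodType R)
  (N : submodClosed M) : Type := {x : M | x \in N}.

Section SubmoduleType.
Context {R : comPzRingType} {M : lmodType R} (N : submodClosed M).
HB.instance Definition _ := SubChoice.on (submodule_type N).
HB.instance Definition _ :=
  [SubChoice_isSubLmodule of submodule_type N by <:].
End SubmoduleType.

Section QuotientModule.
Context {R : comPzRingType} {M : lmodType R}.

(* [Quotient.quot] wants a [zmodClosed]. *)
Definition subgroup_of (N : submodClosed M) : {pred M} := fun x => x \in N.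

Lemma subgroup_of_zmod_closed N : zmod_closed (subgroup_of N).
Proof. exact: (GRing.submod_closedB (GRing.submodClosedP N)). Qed.

HB.instance Definition _ N :=
  GRing.isZmodClosed.Build M (subgroup_of N) (subgroup_of_zmod_closed N).

Definition quotient_module (N : submodClosed M) : Type := Quotient.quot (subgroup_of N).

Variable N : submodClosed M.
Notation Q := (quotient_module N).

HB.instance Definition _ := GRing.Zmodule.on Q.

Definition quotient_proj (x : M) : Q := \pi_(Quotient.quot (subgroup_of N)) x.

Definition quotient_scale (a : R) (x : Q) : Q :=
  quotient_proj (a *: repr (x : Quotient.quot (subgroup_of N))).

Lemma quotient_proj_eq x y : (quotient_proj x = quotient_proj y) <-> x - y \in N.
Proof.
change (x - y \in N) with (x - y \in subgroup_of N).
by rewrite Quotient.idealrBE; split=> /eqP.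
Qed.

Lemma quotient_projD : {morph quotient_proj : x y / x + y}.
Proof. exact: raddfD. Qed.

Lemma quotient_projP (x : Q) : exists y, x = quotient_proj y.
Proof. by exists (repr (x : Quotient.quot (subgroup_of N))); rewrite /quotient_proj reprK. Qed.

Lemma quotient_scaleE a x :
  quotient_scale a (quotient_proj x) = quotient_proj (a *: x).
Proof.
apply/quotient_proj_eq; rewrite -scalerBr rpredZ //.
by apply/quotient_proj_eq; rewrite /quotient_proj reprK.
Qed.

Lemma quotient_scaleA a b x :
  quotient_scale a (quotient_scale b x) = quotient_scale (a * b) x.
Proof. by have [y ->] := quotient_projP x; rewrite !quotient_scaleE scalerA. Qed.

Lemma quotient_scale1 : left_id 1 quotient_scale.
Proof.
by move=> x; have [y ->] := quotient_projP x; rewrite quotient_scaleE scale1r.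
Qed.

Lemma quotient_scaleDr : right_distributive quotient_scale +%R.
Proof.
move=> a x y; have [u ->] := quotient_projP x; have [v ->] := quotient_projP y.
by rewrite -quotient_projD !quotient_scaleE scalerDr quotient_projD.
Qed.

Lemma quotient_scaleDl x : {morph quotient_scale^~ x : a b / a + b}.
Proof.
move=> a b /=; have [u ->] := quotient_projP x.
by rewrite !quotient_scaleE scalerDl quotient_projD.
Qed.

HB.instance Definition _ := GRing.Zmodule_isLmodule.Build R Q
  quotient_scaleA quotient_scale1 quotient_scaleDr quotient_scaleDl.
End QuotientModule.

Section Hom.
Context {R : comPzRingType}.

Definition linear_pred (M N : lmodType R) : {pred M -> N} :=
  fun f => `[< linear f >].
Arguments linear_pred M N _ : clear implicits.

Lemma linear_pred_submod_closed M N : submod_closed (linear_pred M N).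
Proof.
split=> [|a f g /asboolP fl /asboolP gl]; apply/asboolP => b x y.
  by rewrite /= scaler0 addr0.
rewrite -[(a *: f + g) x]/(a *: f x + g x) -[(a *: f + g) y]/(a *: f y + g y).
rewrite -[LHS]/(a *: f (b *: x + y) + g (b *: x + y)) fl gl !scalerDr !scalerA.
by rewrite (mulrC a) addrACA.
Qed.

HB.instance Definition _ (M N : lmodType R) := GRing.isSubmodClosed.Build R (M -> N)
  (linear_pred M N) (linear_pred_submod_closed M N).

Definition hom (M N : lmodType R) : Type := {f : M -> N | f \in linear_pred M N}.

HB.instance Definition _ (M N : lmodType R) := SubChoice.on (hom M N).
HB.instance Definition _ (M N : lmodType R) :=
  [SubChoice_isSubLmodule of hom M N by <:].

Definition dual (M : lmodType R) : lmodType R := hom M R^o.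

Lemma eval_linear (M : lmodType R) (x : M) :
  (fun f : dual M => val f x : R^o) \in linear_pred (dual M) R^o.
Proof. by apply/asboolP => a f g. Qed.

Definition bidual_map (M : lmodType R) (x : M) : dual (dual M) :=
  exist (fun f => f \in linear_pred (dual M) R^o)
    (fun f : dual M => val f x) (eval_linear x).

Definition reflexive_module (M : lmodType R) := bijective (@bidual_map M).
End Hom.

Section FreeModule.
Context (R : comPzRingType) (X : choiceType).

Definition finite_support : {pred X -> R^o} :=
  fun f => `[< finite_set [set x | f x != 0] >].

Lemma finite_support_submod_closed : submod_closed finite_support.
Proof.
split=> [|a f g /asboolP ff /asboolP gf]; apply/asboolP.
  by apply: (@sub_finite_set _ _ set0) => // x /=; rewrite eqxx.
apply: (@sub_finite_set _ _ ([set x | f x != 0] `|` [set x | g x != 0])).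
  move=> x /=; rewrite -[(a *: f + g) x]/(a *: f x + g x) => afg.
  have [f0|] := eqVneq (f x) 0; last by left.
  by right; move: afg; rewrite f0 scaler0 add0r.
by rewrite finite_setU.
Qed.

HB.instance Definition _ := GRing.isSubmodClosed.Build R (X -> R^o)
  finite_support finite_support_submod_closed.

Definition free_module : lmodType R := submodule_type finite_support.

Lemma basis_finite_support (x : X) :
  (fun y => if y == x then 1 else 0 : R^o) \in finite_support.
Proof.
apply/asboolP/(@sub_finite_set _ _ [set x]); last exact: finite_set1.
by move=> y; rewrite /mkset; have [->|_] := eqVneq y x; rewrite ?eqxx.
Qed.

Definition free_basis (x : X) : free_module :=
  exist (fun f => f \in finite_support)
    (fun y => if y == x then 1 else 0) (basis_finite_support x).
End FreeModule.

Section Tensor.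
Context {R : comPzRingType} (M N : lmodType R).
Notation F := (free_module R (M * N)%type).
Notation e m n := (free_basis R (m, n) : F).

Definition tensor_relations : set F :=
  [set z | exists m m' n, z = e (m + m') n - (e m n + e m' n)] `|`
  [set z | exists m n n', z = e m (n + n') - (e m n + e m n')] `|`
  [set z | exists (a : R) m n, z = e (a *: m) n - a *: e m n] `|`
  [set z | exists (a : R) m n, z = e m (a *: n) - a *: e m n].

Definition tensor : lmodType R := quotient_module (span tensor_relations).
End Tensor.

Section LocalizationModule.
Context {R : comPzRingType} (S : mulrClosed R) (M : lmodType R).

Definition fracpair := (M * {s : R | s \in S})%type.
Implicit Types x y z : fracpair.

Definition fracpair_eq x y : bool :=
  `[< exists2 u, u \in S & u *: (val y.2 *: x.1 - val x.2 *: y.1) = 0 >].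

Lemma fracpair_eq_equiv : equiv_class_of fracpair_eq.
Proof.
split=> [x|x y|y x z].
- by apply/asboolP; exists 1; rewrite ?rpred1 // subrr scaler0.
- by apply: asbool_equiv_eq; split=> -[u uS e]; exists u => //;
    rewrite -opprB scalerN e oppr0.
- move=> /asboolP[u uS e] /asboolP[v vS f]; apply/asboolP.
  exists (u * v * val y.2); first by rewrite !rpredM // (valP y.2).
  transitivity ((v * val z.2) *: (u *: (val y.2 *: x.1 - val x.2 *: y.1)) +
      (u * val x.2) *: (v *: (val z.2 *: y.1 - val y.2 *: z.1))).
    rewrite !scalerBr !scalerA addrA; congr (_ - _).
      rewrite -addrA -scaleNr -scalerDl [X in X *: y.1](_ : _ = 0); last by ring.
      by rewrite scale0r addr0; congr (_ *: _); ring.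
    by congr (_ *: _); ring.
  by rewrite e f !scaler0 addr0.
Qed.

Canonical fracpair_equivRel := EquivRelPack fracpair_eq_equiv.
Canonical fracpair_encModRel := defaultEncModRel fracpair_eq.

Definition localization : Type := {eq_quot fracpair_eq}.

HB.instance Definition _ : EqQuotient fracpair fracpair_eq localization :=
  EqQuotient.on localization.
HB.instance Definition _ := Choice.on localization.

Definition frac (m : M) (s : {s : R | s \in S}) : localization := \pi_localization (m, s).

Lemma frac_eq m s n t : frac m s = frac n t <->
  exists2 u, u \in S & u *: (val t *: m - val s *: n) = 0.
Proof.
split=> [/eqmodP/asboolP //|h].
by apply/eqmodP/asboolP.
Qed.

Lemma fracP (x : localization) : exists m s, x = frac m s.
Proof.
by exists (repr x).1, (repr x).2; rewrite /frac -surjective_pairing reprK.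
Qed.

Definition den1 : {s : R | s \in S} := exist (fun s => s \in S) 1 (rpred1 S).
Definition denM (s t : {s : R | s \in S}) : {s : R | s \in S} :=
  exist (fun s => s \in S) (val s * val t) (rpredM (valP s) (valP t)).

Definition loc_zero : localization := frac 0 den1.
Definition loc_add (x y : localization) : localization :=
  let p := repr x in let q := repr y in
  frac (val q.2 *: p.1 + val p.2 *: q.1) (denM p.2 q.2).
Definition loc_opp (x : localization) : localization :=
  frac (- (repr x).1) (repr x).2.

Lemma frac_repr m s : exists2 u, u \in S &
  u *: (val s *: (repr (frac m s)).1 - val (repr (frac m s)).2 *: m) = 0.
Proof.
apply/(frac_eq (repr (frac m s)).1 (repr (frac m s)).2).
by rewrite /frac -surjective_pairing reprK.
Qed.

Lemma loc_addE m s n t : loc_add (frac m s) (frac n t) =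
  frac (val t *: m + val s *: n) (denM s t).
Proof.
rewrite /loc_add; have [u uS] := frac_repr m s; have [v vS] := frac_repr n t.
case: (repr (frac m s)) => m' s'; case: (repr (frac n t)) => n' t' /= f e.
apply/frac_eq; exists (u * v); first exact: rpredM.
transitivity ((v * val t * val t') *: (u *: (val s *: m' - val s' *: m)) +
    (u * val s * val s') *: (v *: (val t *: n' - val t' *: n))); last first.
  by rewrite e f !scaler0 addr0.
rewrite /= !(scalerBr, scalerDr) !scalerA opprD addrACA.
by congr (_ *: _ - _ *: _ + (_ *: _ - _ *: _)); ring.
Qed.

Lemma loc_oppE m s : loc_opp (frac m s) = frac (- m) s.
Proof.
rewrite /loc_opp; have [u uS] := frac_repr m s.
case: (repr (frac m s)) => m' s' /= e; apply/frac_eq; exists u => //.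
by rewrite !scalerN -opprD scalerN e oppr0.
Qed.

Lemma frac_cong m s n t : val t *: m = val s *: n -> frac m s = frac n t.
Proof.
by move=> e; apply/frac_eq; exists 1; rewrite ?rpred1 // e subrr scaler0.
Qed.

Lemma loc_addA : associative loc_add.
Proof.
move=> x y z; have [m [s ->]] := fracP x; have [n [t ->]] := fracP y.
have [p [r ->]] := fracP z; rewrite !loc_addE; apply: frac_cong => /=.
rewrite !scalerDr !scalerA addrA.
by congr (_ *: _ + _ *: _ + _ *: _); ring.
Qed.

Lemma loc_addC : commutative loc_add.
Proof.
move=> x y; have [m [s ->]] := fracP x; have [n [t ->]] := fracP y.
by rewrite !loc_addE addrC; apply: frac_cong => /=; rewrite mulrC.
Qed.

Lemma loc_add0 : left_id loc_zero loc_add.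
Proof.
move=> x; have [m [s ->]] := fracP x; rewrite loc_addE; apply: frac_cong => /=.
by rewrite scaler0 add0r scale1r mul1r.
Qed.

Lemma loc_addN : left_inverse loc_zero loc_opp loc_add.
Proof.
move=> x; have [m [s ->]] := fracP x; rewrite loc_oppE loc_addE.
by apply: frac_cong; rewrite /= scalerN addNr !scaler0.
Qed.

HB.instance Definition _ :=
  GRing.isZmodule.Build localization loc_addA loc_addC loc_add0 loc_addN.

Lemma fracD m s n t :
  frac m s + frac n t = frac (val t *: m + val s *: n) (denM s t).
Proof. exact: loc_addE. Qed.
End LocalizationModule.

Section LocalizationRing.
Context {R : comPzRingType} (S : mulrClosed R).

Notation regR := [the lmodType R of R^o].

Definition loc_ring : Type := localization S regR.

HB.instance Definition _ := GRing.Zmodule.on loc_ring.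

Section Scale.
Context {M : lmodType R}.

Definition loc_scale (a : loc_ring) (x : localization S M) : localization S M :=
  let p := repr (a : localization S regR) in let q := repr x in
  frac ((p.1 : R) *: q.1) (denM p.2 q.2).

Lemma loc_scaleE (a : R) s (m : M) t :
  loc_scale (frac (a : regR) s) (frac m t) = frac (a *: m) (denM s t).
Proof.
rewrite /loc_scale; have [u uS] := frac_repr (a : regR) s; have [v vS] := frac_repr m t.
case: (repr (frac (a : regR) s)) => a' s'; case: (repr (frac m t)) => m' t' /= f e.
have {}e : u * (val s * a' - val s' * a) = 0 by [].
apply/frac_eq; exists (u * v); first exact: rpredM.
transitivity ((u * val s * a') *: (v *: (val t *: m' - val t' *: m)) +
   (v * val t' * (u * (val s * a' - val s' * a))) *: m); last first.
  by rewrite e f scaler0 mulr0 scale0r addr0.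
rewrite /= !scalerBr !scalerA -addrA -scaleNr -[in RHS]scaleNr -scalerDl.
by congr (_ *: _ + _ *: _); ring.
Qed.
End Scale.

Let regE (a b : R) : a *: (b : regR) = a * b. Proof. by []. Qed.

Definition loc_one : loc_ring := frac (1 : regR) (den1 S).
Definition loc_mul (a b : loc_ring) : loc_ring := loc_scale a b.

Lemma loc_scaleA M (a b : loc_ring) (x : localization S M) :
  loc_scale a (loc_scale b x) = loc_scale (loc_mul a b) x.
Proof.
have [a' [s ->]] := fracP a; have [b' [t ->]] := fracP b.
have [m [r ->]] := fracP x; rewrite /loc_mul !loc_scaleE.
by apply: frac_cong; rewrite /= !scalerA regE; congr (_ *: _); ring.
Qed.

Lemma loc_scale1 M : left_id loc_one (@loc_scale M).
Proof.
move=> x; have [m [s ->]] := fracP x; rewrite loc_scaleE.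
by apply: frac_cong; rewrite /= scale1r mul1r.
Qed.

Lemma loc_scaleDr M : right_distributive (@loc_scale M) +%R.
Proof.
move=> a x y; have [a' [s ->]] := fracP a; have [m [t ->]] := fracP x.
have [n [r ->]] := fracP y; rewrite fracD !loc_scaleE fracD.
apply: frac_cong; rewrite /= !(scalerDr, scalerA).
by congr (_ *: _ + _ *: _); ring.
Qed.

Lemma loc_scaleDl M (x : localization S M) :
  {morph (@loc_scale M)^~ x : a b / a + b}.
Proof.
move=> a b /=; have [a' [s ->]] := fracP a; have [b' [t ->]] := fracP b.
have [m [r ->]] := fracP x; rewrite fracD !loc_scaleE fracD.
apply: frac_cong; rewrite /= !regE scalerDr !scalerA -!scalerDl.
by congr (_ *: _); ring.
Qed.

Lemma loc_mulA : associative loc_mul. Proof. exact: loc_scaleA. Qed.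

Lemma loc_mulC : commutative loc_mul.
Proof.
move=> a b; have [a' [s ->]] := fracP a; have [b' [t ->]] := fracP b.
rewrite /loc_mul !loc_scaleE; apply: frac_cong => /=.
by rewrite /GRing.scale /=; ring.
Qed.

Lemma loc_mulDl : left_distributive loc_mul +%R.
Proof. by move=> a b c; exact: loc_scaleDl. Qed.

HB.instance Definition _ := GRing.Zmodule_isComPzRing.Build loc_ring
  loc_mulA loc_mulC (@loc_scale1 R^o) loc_mulDl.

HB.instance Definition _ (M : lmodType R) :=
  GRing.Zmodule_isLmodule.Build loc_ring (localization S M)
    (@loc_scaleA M) (@loc_scale1 M) (@loc_scaleDr M) (@loc_scaleDl M).

Definition to_loc (a : R) : loc_ring := frac (a : regR) (den1 S).

Lemma to_loc_zmod_morphism : zmod_morphism to_loc.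
Proof.
move=> a b; rewrite /to_loc -[RHS]/(frac (a : regR) _ + loc_opp (frac (b : regR) _)).
rewrite loc_oppE fracD; apply: frac_cong => /=.
by rewrite /GRing.scale /=; ring.
Qed.

Lemma to_loc_monoid_morphism : monoid_morphism to_loc.
Proof.
split=> // a b; rewrite /to_loc -[RHS]/(loc_scale (frac _ _) (frac _ _)).
by rewrite loc_scaleE; apply: frac_cong; rewrite /= mulr1.
Qed.

HB.instance Definition _ :=
  GRing.isZmodMorphism.Build R loc_ring to_loc to_loc_zmod_morphism.
HB.instance Definition _ :=
  GRing.isMonoidMorphism.Build R loc_ring to_loc to_loc_monoid_morphism.
End LocalizationRing.

Section Ideals.
Context {R : comPzRingType}.
Implicit Types I J : ideal R.

Definition ideal_mul I J : ideal R :=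
  span [set z : R^o | exists a b : R, [/\ a \in I, b \in J & z = a * b]].

Fixpoint ideal_pow I (n : nat) : ideal R :=
  if n is n'.+1 then ideal_mul I (ideal_pow I n') else span [set (1 : R^o)].

Definition integral_closure I : set R :=
  [set x | exists n (a : nat -> R), [/\ (0 < n)%N,
     forall i, (1 <= i <= n)%N -> a i \in ideal_pow I i &
     x ^+ n + \sum_(1 <= i < n.+1) a i * x ^+ (n - i) = 0]].

Definition integrally_closed I : Prop := integral_closure I = [set x : R | x \in I].

Definition maximal_ideal I : Prop :=
  1 \notin I /\
  forall J, {subset I <= J} -> 1 \notin J -> {subset J <= I}.

Definition prime_ideal (P : {pred R^o}) : Prop :=
  [/\ submod_closed P, 1 \notin P &
      forall a b : R, a * b \in P -> a \in P \/ b \in P].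
End Ideals.

(* The field is a plain function because [{pred R}] and [ideal R] live in
   universes that are too large for [set (spec R)]. *)
Record spec (R : comPzRingType) :=
  Spec { spec_pred : R^o -> bool; specP : prime_ideal spec_pred }.

Section SpecIdeal.
Context {R : comPzRingType}.

Definition spec_mem (p : spec R) : {pred R^o} := spec_pred p.

Lemma spec_submod_closed p : submod_closed (spec_mem p).
Proof. by case: (specP p). Qed.

HB.instance Definition _ p :=
  GRing.isSubmodClosed.Build R R^o (spec_mem p) (spec_submod_closed p).

Definition spec_ideal (p : spec R) : ideal R := spec_mem p.
End SpecIdeal.
Coercion spec_ideal : spec >-> GRing.SubmodClosed.type.

Definition prime_compl (R : comPzRingType) (p : spec R) : {pred R} :=
  fun s => s \notin p.

Lemma prime_compl_mulr_closed (R : comPzRingType) (p : spec R) :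
  mulr_closed (prime_compl p).
Proof.
have [_ p1 pM] := specP p; split=> // a b ap bp.
by apply/negP => /pM[]; apply/negP.
Qed.

HB.instance Definition _ (R : comPzRingType) (p : spec R) :=
  GRing.isMulClosed.Build R (prime_compl p) (prime_compl_mulr_closed p).

Section LocalizationAtPrime.
Context {R : comPzRingType} (p : spec R).

Definition local_ring : comPzRingType := loc_ring (prime_compl p).

Definition local_module (M : lmodType R) : lmodType local_ring :=
  localization (prime_compl p) M.

(* The ideal [J R_p] of [R_p]. *)
Definition local_ideal (J : ideal R) : ideal local_ring :=
  span [set z : local_ring^o | exists2 a : R, a \in J & z = to_loc _ a].

Definition symbolic_power_pred (n : nat) : {pred R^o} :=
  fun a => to_loc (prime_compl p) a \in local_ideal (ideal_pow p n).

Lemma symbolic_power_submod_closed n : submod_closed (symbolic_power_pred n).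
Proof.
pose L : {rmorphism R -> local_ring} := to_loc (prime_compl p).
pose Q := local_ideal (ideal_pow p n).
split=> [|a x y xp yp].
  by change (L 0 \in Q); rewrite rmorph0; exact: rpred0.
change (L (a * x + y) \in Q); rewrite rmorphD rmorphM.
by apply: (@rpredD _ Q) yp; exact: (rpredZ (L a) xp).
Qed.

HB.instance Definition _ n := GRing.isSubmodClosed.Build R R^o
  (symbolic_power_pred n) (symbolic_power_submod_closed n).

Definition symbolic_power (n : nat) : ideal R := symbolic_power_pred n.
End LocalizationAtPrime.

(* Values are taken in [\bar int]: the empty set has supremum [-oo] and infimum
   [+oo], so that the zero ring has dimension [-oo] and the unit ideal has
   height [+oo]. *)
Definition nat_sup (A : set nat) : \bar int :=
  supremum -oo%E [set n%:Z%:E | n in A].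

Definition prime_chain (R : comPzRingType) (c : nat -> spec R) (n : nat) :=
  forall i, (i < n)%N -> {subset c i <= c i.+1} /\ ~ {subset c i.+1 <= c i}.

Definition krull_dim (R : comPzRingType) : \bar int :=
  nat_sup [set n | exists c : nat -> spec R, prime_chain c n].

Definition prime_height (R : comPzRingType) (p : spec R) : \bar int :=
  nat_sup [set n | exists2 c : nat -> spec R, prime_chain c n & c n =i p].

Definition height (R : comPzRingType) (I : ideal R) : \bar int :=
  infimum +oo%E
    [set prime_height p | p in [set p : spec R | {subset I <= p}]].

Definition regular_sequence (R : comPzRingType) (s : seq R^o) : Prop :=
  1 \notin span [set` s] /\
  forall i, (i < size s)%N -> forall y : R,
    s`_i * y \in span [set` take i s] -> y \in span [set` take i s].

(* The depth of a local ring [R] is [depth m] for its maximal ideal [m]; in a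
   Noetherian local ring all maximal regular sequences in [m] have this length. *)
Definition depth (R : comPzRingType) (m : ideal R) : \bar int :=
  nat_sup [set n | exists s : seq R^o,
    [/\ regular_sequence s, {subset s <= m} & size s = n]].

Definition serre_condition (n : nat) (R : comPzRingType) : Prop :=
  forall p : spec R,
    (Order.min n%:Z%:E (krull_dim (local_ring p)) <= depth (local_ideal p p))%E.

Definition finitely_generated (R : comPzRingType) (M : lmodType R) : Prop :=
  exists s : seq M, forall x : M, x \in span [set` s].

Definition noetherian (R : comPzRingType) : Prop :=
  forall I : ideal R, finitely_generated (submodule_type I).

Definition projective (R : comPzRingType) (P : lmodType R) : Prop :=
  forall (M N : lmodType R) (g : {linear M -> N}) (f : {linear P -> N}),
    (forall y, exists x, g x = y) ->
    exists h : {linear P -> M}, forall x, g (h x) = f x.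

Definition isomorphic (R : comPzRingType) (M N : lmodType R) : Prop :=
  exists f : {linear M -> N}, bijective f.

(* [M] represents an element of the Picard group. *)
Definition in_Pic (R : comPzRingType) (M : lmodType R) : Prop :=
  [/\ finitely_generated M, projective M &
      forall p : spec R, isomorphic (local_module p M) (local_ring p)^o].

Definition discrete_valuation_ring (R : comPzRingType) : Prop :=
  [/\ (1 : R) != 0,
      forall a b : R, a * b = 0 -> a = 0 \/ b = 0,
      forall J : ideal R, exists a : R, J =i span [set (a : R^o)] &
      exists m : ideal R,
        [/\ maximal_ideal m, exists2 a : R, a \in m & a != 0 &
            forall m' : ideal R, maximal_ideal m' -> m' =i m]].

Definition Ass (R : comPzRingType) (M : lmodType R) : set (spec R) :=
  [set p : spec R | exists x : M, forall a : R, a \in p <-> a *: x = 0].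

Definition primary_to (R : comPzRingType) (p : spec R) (q : ideal R) : Prop :=
  [/\ 1 \notin q,
      forall a b : R, a * b \in q -> a \in q \/ exists n, b ^+ n \in q &
      forall a : R, a \in p <-> exists n, a ^+ n \in q].

Definition primary_decomposition (R : comPzRingType) (I : ideal R)
    (A : set (spec R)) (q : spec R -> ideal R) : Prop :=
  [/\ finite_set A, forall p, A p -> primary_to p (q p) &
      [set x : R | x \in I] = \bigcap_(p in A) [set x : R | x \in q p]].

(* Main.v *)
(* A nonzerodivisor [a0] of [I] exists by (S1) and prime avoidance, and [I] lies in
   the Picard group iff the trace map [tr : T -> R], [T = I (x) I^*], attains 1.

   (i) => (ii): if [p = (I : y)] and [a] generates [I R_p], then either [b y] is a
   unit multiple of [a] for some [b] in [p], which is then a uniformizer, or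
   [y p R_p] lies in [a p R_p] and [y] is integral over [I].
   (ii) => (i): if [p = (I : z)] and [t] is a uniformizer, then [I R_p = (t z)], and
   an equation of integral dependence of [z] reads [z^n (1 + t w) = 0].

   (iii) => (i): [tr(e) t = tr(t) e] on [T], so [tr] is injective as soon as [T]
   is torsionless, and [tr] attains 1 as soon as [a0] divides [G (a0 (x) incl)]
   for every [G] in [T^*]. If it does not, some [p = ((a0) : y)] contains [I],
   where [y] is a multiple of [G (a0 (x) incl)]. The depth of [R_p] is 1, so by
   (S2) [p] is minimal over [I], hence [p = (I : z)]. A relation between minimal
   generators [f_1, ..., f_r] of [I^*] at [p] has its coefficients in [p]; if
   [r >= 2], the element [sum (z k_j) (x) f_j = 0] of [T] shows that [z L <= I L]
   for the ideals [L = ((f_j)_(j <> i) : f_i)], whence [z] is integral over [I].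
   If [r = 1], [y / a0] maps the principal module [I^*_p] into itself, so [a0]
   divides [y] at [p]. *)
Require Import Defs.
From HB Require Import structures.
From mathcomp Require Import fingroup perm.
From mathcomp Require Import all_boot all_order all_algebra.
From mathcomp Require Import boolp classical_sets functions cardinality.
From mathcomp Require Import constructive_ereal fsbigop ring.

Set Implicit Arguments.
Unset Strict Implicit.
Unset Printing Implicit Defensive.

Import Order.TTheory GRing.Theory Num.Theory.
Local Open Scope ring_scope.

Local Notation span := Defs.span.
Local Notation frac := Defs.frac.

(** * Submodules, ideals and chain conditions *)

(** Submodules are packed Boolean predicates; classical decidability lets any closed property define
    one. *)
Lemma ex_submod (R : comPzRingType) (M : lmodType R) (P : M -> Prop) :
  P 0 -> (forall a x y, P x -> P y -> P (a *: x + y)) ->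
  exists N : submodClosed M, forall x, x \in N <-> P x.
Proof.
move=> P0 PD; pose A : {pred M} := fun x => `[< P x >].
have cA : submod_closed A.
  by split=> [|a x y /asboolP Px /asboolP Py]; apply/asboolP => //; exact: PD.
pose N : submodClosed M := HB.pack A (GRing.isSubmodClosed.Build R M A cA).
by exists N => x; split=> [/asboolP|Px] //; exact/asboolP.
Qed.

Lemma span_ind (R : comPzRingType) (M : lmodType R) (X : set M) (P : M -> Prop) :
  P 0 -> (forall a x y, P x -> P y -> P (a *: x + y)) ->
  (forall y, X y -> P y) -> forall x, x \in span X -> P x.
Proof.
move=> P0 PD XP x /asboolP xX; have [N NP] := ex_submod P0 PD.
by apply/NP/xX => y /XP Py; exact/NP.
Qed.

Lemma mem_span (R : comPzRingType) (M : lmodType R) (X : set M) (x : M) :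
  X x -> x \in span X.
Proof. by move=> Xx; apply/asboolP => N; exact. Qed.

Section IdealBasics.
Context (R : comPzRingType).
Implicit Types (I J : ideal R) (a b x y : R).

Lemma idealMl I a x : x \in I -> a * x \in I.
Proof. exact: (rpredZ a). Qed.

Lemma idealMr I a x : x \in I -> x * a \in I.
Proof. by rewrite mulrC; exact: idealMl. Qed.

Lemma idealD I x y : x \in I -> y \in I -> x + y \in I.
Proof. exact: (@rpredD _ I). Qed.

Lemma idealB I x y : x \in I -> y \in I -> x - y \in I.
Proof. by move=> xI yI; rewrite -mulN1r; apply: idealD => //; exact: idealMl. Qed.

Lemma ideal0 I : (0 : R) \in I.
Proof. exact: (@rpred0 _ I). Qed.

Lemma ideal_sum I (K : Type) (r : seq K) (P : pred K) (F : K -> R) :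
  (forall i, P i -> F i \in I) -> \sum_(i <- r | P i) F i \in I.
Proof. exact: (@rpred_sum _ I). Qed.

Lemma ex_ideal (P : R -> Prop) :
  P 0 -> (forall a x y, P x -> P y -> P (a * x + y)) ->
  exists J : ideal R, forall x, x \in J <-> P x.
Proof. exact: (@ex_submod R R^o). Qed.

Lemma mem_span1 a x : x \in span [set (a : R^o)] <-> exists c, x = c * a.
Proof.
split=> [|[c ->]]; last by apply: idealMl; exact: mem_span.
move: x; apply: (@span_ind R R^o) => [|b x y [c ->] [d ->]|y ->].
- by exists 0; rewrite mul0r.
- by exists (b * c + d); rewrite mulrDl -[in RHS]mulrA.
- by exists 1; rewrite mul1r.
Qed.

Lemma prime_notin1 (p : spec R) : (1 : R) \notin p.
Proof. by case: (specP p). Qed.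

Lemma prime_mem_mul (p : spec R) a b : a * b \in p -> a \in p \/ b \in p.
Proof. by case: (specP p) => _ _; apply. Qed.

Lemma prime_notinM (p : spec R) a b : a \notin p -> b \notin p -> a * b \notin p.
Proof. by move=> ap bp; exact: (@rpredM _ (prime_compl p)). Qed.

Lemma prime_notinX (p : spec R) a n : a \notin p -> a ^+ n \notin p.
Proof. by move=> ap; exact: (@rpredX _ (prime_compl p)). Qed.

Lemma ex_spec (P : R -> Prop) :
  P 0 -> (forall a x y, P x -> P y -> P (a * x + y)) -> ~ P 1 ->
  (forall a b, P (a * b) -> P a \/ P b) ->
  exists p : spec R, forall x, x \in p <-> P x.
Proof.
move=> P0 PD P1 PM; pose A : R^o -> bool := fun x => `[< P x >].
have pA : prime_ideal (A : {pred R^o}).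
  split.
  - split=> [|a x y /asboolP Px /asboolP Py]; apply/asboolP => //; exact: PD.
  - by apply/negP => /asboolP.
  - by move=> a b /asboolP/PM[] h; [left|right]; exact/asboolP.
by exists (Spec pA) => x; split=> [/asboolP|Px] //; exact/asboolP.
Qed.

Lemma eq_spec (p q : spec R) : p =i q -> p = q.
Proof.
case: p q => [p Pp] [q Pq] pq.
have e : p = q by apply/funext => x; exact: pq x.
by subst q; congr Spec; exact: Prop_irrelevance.
Qed.

Lemma fg_ideal (noethR : noetherian R) I :
  exists n (f : 'I_n -> R), (forall i, f i \in I) /\
    forall x, x \in I -> exists c : 'I_n -> R, x = \sum_i c i * f i.
Proof.
have [s sP] := noethR I; exists (size s), (fun i => val (tnth (in_tuple s) i)).
split=> [i|x xI]; first exact: (valP (tnth (in_tuple s) i)).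
suff gen (z : submodule_type I) : z \in span [set` s] ->
    exists c : 'I_(size s) -> R, val z = \sum_i c i * val (tnth (in_tuple s) i).
  exact: gen (sP (exist _ x xI)).
move: z; apply: span_ind => [|a y z [c cy] [d dz]|y ys].
- by exists (fun=> 0); rewrite big1 // => i _; rewrite mul0r.
- exists (fun i => a * c i + d i).
  transitivity (a * val y + val z) => //.
  rewrite cy dz mulr_sumr -big_split /=; apply: eq_bigr => i _.
  by rewrite mulrDl -mulrA.
- have /tnthP[j ->] : y \in in_tuple s by [].
  exists (fun i => (i == j)%:R).
  rewrite (bigD1 j) //= eqxx mul1r big1 ?addr0 // => i /negPf ->.
  by rewrite mul0r.
Qed.

(** Each of the finitely many generators of the union lies in some member; the chain is stationary
    at the largest such index. *)
Lemma ideal_acc (noethR : noetherian R) (c : nat -> ideal R) :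
  (forall n, {subset c n <= c n.+1}) -> exists n, {subset c n.+1 <= c n}.
Proof.
move=> cS.
have cM m n : (m <= n)%N -> {subset c m <= c n}.
  move=> /subnKC <-; elim: (n - m)%N => [|k IH] x xm; first by rewrite addn0.
  by rewrite addnS; apply/cS/IH.
have [||U UP] := @ex_ideal (fun x => exists n, x \in c n).
- by exists 0%N; exact: ideal0.
- move=> a x y [m xm] [n yn]; exists (maxn m n); apply/idealD/(cM n) => //.
    by apply/idealMl/(cM m) => //; exact: leq_maxl.
  exact: leq_maxr.
have [k [f [fU gU]]] := fg_ideal noethR U.
have [m mP] := choice (fun i => (UP _).1 (fU i)).
exists (\max_i m i)%N => x xc.
have /gU[d ->] : x \in U by apply/UP; eexists; exact: xc.
by apply: ideal_sum => i _; apply/idealMl/(cM _ _ _ _ (mP i)); exact: leq_bigmax.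
Qed.

Lemma ideal_max (noethR : noetherian R) (P : ideal R -> Prop) I : P I ->
  exists2 J, P J & forall J', P J' -> {subset J <= J'} -> {subset J' <= J}.
Proof.
move=> PI; apply: contrapT => nmax.
have step (J : {J : ideal R | P J}) :
    exists J' : {J : ideal R | P J}, {subset sval J <= sval J'} /\ ~ {subset sval J' <= sval J}.
  case: J => J PJ; apply: contrapT => h; apply: nmax; exists J => // J' PJ' JJ'.
  by apply: contrapT => nJ; apply: h; exists (exist _ J' PJ').
have [f fP] := choice step.
pose c n := sval (iter n f (exist _ I PI)).
have [n nP] := @ideal_acc noethR c (fun n => (fP _).1).
exact: (fP (iter n f (exist _ I PI))).2 nP.
Qed.

End IdealBasics.

(** * Associated primes *)

Section AssociatedPrimes.
Context (R : comPzRingType).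
Implicit Types (I J : ideal R) (p q : spec R) (a b x y z : R).

(** This is [p = (I : z)]: the class of [z] witnesses that [p] is associated to [R/I]. *)
Definition colon_prime I z p := forall a, a \in p <-> a * z \in I.

Lemma Ass_quotient I p :
  Ass (quotient_module I) p <-> exists z, colon_prime I z p.
Proof.
have proj0 x : quotient_proj I (x : R^o) = 0 <-> x \in I.
  have -> : 0 = quotient_proj I 0.
    by apply: (@addrI _ (quotient_proj I 0)); rewrite -quotient_projD !addr0.
  by rewrite quotient_proj_eq subr0.
split=> [[x xp]|[z zp]].
  have [z xz] := quotient_projP x; exists z => a.
  by rewrite xp xz -proj0 -quotient_scaleE.
exists (quotient_proj I (z : R^o)) => a.
by rewrite zp -proj0 -quotient_scaleE.
Qed.

Lemma ex_colon I z : exists J : ideal R, forall a, a \in J <-> a * z \in I.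
Proof.
apply: ex_ideal => [|a x y xI yI]; first by rewrite mul0r ideal0.
by rewrite mulrDl -mulrA; apply/idealD/yI/idealMl.
Qed.

Lemma colon_prime_sub I z p : colon_prime I z p -> {subset I <= p}.
Proof. by move=> zp a aI; apply/zp/idealMr. Qed.

Lemma colon_primeM I z p u :
  colon_prime I z p -> u \notin p -> colon_prime I (u * z) p.
Proof.
move=> zp up a; rewrite mulrA -zp; split=> [|/prime_mem_mul[//|]]; first exact: idealMr.
by rewrite (negPf up).
Qed.

(** A colon ideal [(I : u * z)] that is maximal among those disjoint from [S] is prime. *)
Lemma ex_colon_prime_disjoint (noethR : noetherian R) I z (S : R -> Prop) :
  S 1 -> (forall s t, S s -> S t -> S (s * t)) -> (forall s, S s -> s * z \notin I) ->
  exists u p, colon_prime I (u * z) p /\ forall s, S s -> s \notin p.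
Proof.
move=> S1 SM Sz.
pose P J := exists2 u : R, forall a, a \in J <-> a * (u * z) \in I &
  forall s, S s -> s \notin J.
have [J0 J0P] := ex_colon I z.
have PJ0 : P J0.
  exists 1 => [a|s Ss]; first by rewrite mul1r.
  by apply/negP => /J0P; apply/negP/Sz.
have [J [u uP SJ] Jmax] := ideal_max noethR PJ0.
have Jprime a b : a * b \in J -> a \in J \/ b \in J.
  move=> abJ; have [bJ|bJ] := boolP (b \in J); [by right|left].
  have [Ja JaP] := ex_colon I (a * u * z).
  have JJa : {subset J <= Ja}.
    by move=> c /uP cJ; apply/JaP; rewrite -mulrA mulrCA; exact: idealMl.
  have bJa : b \in Ja.
    by apply/JaP; move/uP: abJ; congr (_ \in I); ring.
  have /existsNP[s /not_implyP[Ss /negP/negPn sJa]] : ~ forall s, S s -> s \notin Ja.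
    move=> SJa; move/negP: bJ; apply; apply: (Jmax Ja) => //.
    by exists (a * u) => // c; rewrite JaP mulrA.
  (* Some [s] of [S] multiplies [a * u * z] into [I], so passing from [u] to [s * u] puts [a] in the
     colon ideal, which stays disjoint from [S] because [S] is multiplicative. *)
  have [Js JsP] := ex_colon I (s * u * z).
  apply: (Jmax Js).
  - exists (s * u) => [c|t St]; first by rewrite JsP mulrA.
    apply/negP => /JsP; rewrite -mulrA mulrA => /uP.
    by apply/negP/SJ/SM.
  - by move=> c /uP cJ; apply/JsP; rewrite -mulrA mulrCA; exact: idealMl.
  - by apply/JsP; move/JaP: sJa; congr (_ \in I); ring.
have [||||p pJ] := @ex_spec _ (fun x => x \in J).
- exact: ideal0.
- by move=> a x y xJ yJ; apply/idealD/yJ/idealMl.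
- exact/negP/SJ.
- exact: Jprime.
exists u, p; split=> [a|s Ss]; first by rewrite pJ uP.
by apply/negP => /pJ; exact/negP/SJ.
Qed.

Lemma ex_colon_prime (noethR : noetherian R) I z : z \notin I ->
  exists u p, colon_prime I (u * z) p.
Proof.
move=> zI; have [|s t -> ->|s ->|u [p [zp _]]] :=
  @ex_colon_prime_disjoint noethR I z (fun s => s = 1); rewrite ?mul1r //.
by exists u, p.
Qed.

(** With [S] the complement of [p] and [z = 1], the colon prime found contains [I] and lies inside
    [p]. *)
Lemma colon_prime_minimal (noethR : noetherian R) I p : {subset I <= p} ->
  (forall q, {subset I <= q} -> {subset q <= p} -> {subset p <= q}) ->
  exists z, colon_prime I z p.
Proof.
move=> Ip pmin.
have [||s|u [q [uq qp]]] := @ex_colon_prime_disjoint noethR I 1 (fun s => s \notin p).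
- exact: prime_notin1.
- exact: prime_notinM.
- by rewrite mulr1; apply: contra => /Ip.
have qp' : {subset q <= p} by move=> a aq; apply/negPn/negP => /qp; rewrite aq.
have pq : q =i p.
  move=> a; apply/idP/idP; first exact: qp'.
  exact: (pmin q (colon_prime_sub uq) qp').
by exists (u * 1) => a; rewrite -uq pq.
Qed.

HB.instance Definition _ := gen_eqMixin (spec R).

(** Noetherian induction: if [p = (J : z)], every prime associated to [R/J] is [p] or is associated
    to [R/J'] for [J' = J + R z]. *)
Lemma finite_colon_primes (noethR : noetherian R) I :
  exists s : seq (spec R), forall z p, colon_prime I z p -> p \in s.
Proof.
apply: contrapT => nI.
have [J nJ Jmax] := ideal_max noethR (P := fun I => ~ exists s : seq (spec R),
  forall z p, colon_prime I z p -> p \in s) nI.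
have [z [p zp]] : exists z p, colon_prime J z p.
  apply: contrapT => h; apply: nJ; exists [::] => z p zp.
  by case: h; exists z, p.
have [||J' J'P] := @ex_ideal _ (fun x => exists c, x - c * z \in J).
- by exists 0; rewrite mul0r subr0 ideal0.
- move=> a x y [c xc] [d yd]; exists (a * c + d).
  have -> : a * x + y - (a * c + d) * z = a * (x - c * z) + (y - d * z) by ring.
  by apply/idealD/yd/idealMl.
have zJ : z \notin J.
  by apply/negP; rewrite -[z]mul1r => /zp; apply/negP/prime_notin1.
have zJ' : z \in J' by apply/J'P; exists 1; rewrite mul1r subrr ideal0.
have JJ' : {subset J <= J'}.
  by move=> a aJ; apply/J'P; exists 0; rewrite mul0r subr0.
have /contrapT[s sP] : ~ ~ exists s : seq (spec R),
    forall z p, colon_prime J' z p -> p \in s.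
  by move=> nJ'; move/negP: zJ; apply; exact: (Jmax J').
apply: nJ; exists (p :: s) => y q yq; rewrite inE.
(* If a multiple [u * y] is in [J'] but not in [J], it is some [c * z] modulo [J], and
   [q = (J : u * y) = (J : c * z) = p]. Otherwise [q = (J' : y)]. *)
have [[u uJ' uJ]|h] := pselect (exists2 u : R, u * y \in J' & u * y \notin J).
  apply/orP; left; apply/eqP/eq_spec => a.
  have uq : u \notin q by apply: contra uJ => /yq.
  have /J'P[c uc] := uJ'.
  have aE d : (d * (u * y) \in J) = (d * (c * z) \in J).
    apply/idP/idP => h.
      have -> : d * (c * z) = d * (u * y) - d * (u * y - c * z) by ring.
      by apply/idealB/idealMl/uc.
    have -> : d * (u * y) = d * (c * z) + d * (u * y - c * z) by ring.
    by apply/idealD/idealMl/uc.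
  have cp : c \notin p.
    by apply: contra uJ => /zp; rewrite -[u * y]mul1r aE mul1r.
  apply/idP/idP.
    by move/(colon_primeM yq uq); rewrite aE => /(colon_primeM zp cp).
  by move/(colon_primeM zp cp); rewrite -aE => /(colon_primeM yq uq).
apply/orP; right; apply: (sP y) => a; rewrite yq; split=> [/JJ' //|ayJ'].
by apply: contrapT => ayJ; apply: h; exists a => //; exact/negP.
Qed.

Lemma prime_avoidance I (s : seq (spec R)) :
  (forall p, p \in s -> ~ {subset I <= p}) ->
  exists2 x : R, x \in I & forall p, p \in s -> x \notin p.
Proof.
have [n] := ubnP (size s); elim: n s => // n IH [|q s] sn sP.
  by exists 0; rewrite ?ideal0.
(* Avoiding [q] avoids every prime inside [q]. None of the remaining primes lies in [q], and neither
   does [I], so a product gives the [y] below, which corrects [x] when [x] is in [q]. *)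
pose s' := [seq p : spec R <- s | ~~ `[< {subset p <= q} >]].
have [||x xI xs'] := IH s'.
- by rewrite size_filter; apply: leq_ltn_trans (count_size _ _) _.
- by move=> p; rewrite mem_filter => /andP[_ ps]; apply: sP; rewrite inE ps orbT.
have good y : y \in I -> y \notin q -> (forall p, p \in s' -> y \notin p) ->
    exists2 x : R, x \in I & forall p, p \in q :: s -> x \notin p.
  move=> yI yq ys'; exists y => // p; rewrite inE => /predU1P[-> //|ps].
  have [/asboolP pq|pq] := boolP (`[< {subset p <= q} >]).
    by apply: contra yq => /pq.
  by apply: ys'; rewrite mem_filter pq.
have [xq|] := boolP (x \in q); last by move=> xq; exact: (good x).
have [y [yI yq ys']] : exists y, [/\ y \in I, y \notin q & forall p, p \in s' -> y \in p].
  have : forall p, p \in s' -> ~ {subset p <= q}.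
    by move=> p; rewrite mem_filter => /andP[/asboolP].
  elim: s' {xs' good IH} => [_|p s' IHs ps'].
    have /existsNP[y /not_implyP[yI /negP yq]] := sP q (mem_head _ _).
    by exists y.
  have [r rs'|y [yI yq ys']] := IHs; first by apply: ps'; rewrite inE rs' orbT.
  have /existsNP[a /not_implyP[ap /negP aq]] := ps' p (mem_head _ _).
  exists (a * y); split; [exact: idealMl|exact: prime_notinM|].
  move=> r; rewrite inE => /predU1P[->|/ys' ry]; first exact: idealMr.
  exact: idealMl.
apply: (good (x + y)) => [||p ps']; first exact: idealD.
  by apply: contra yq => h; rewrite -[y](addKr x) addrC -[_ + - x]/(_ - x); exact: idealB.
apply: contra (xs' p ps') => h; rewrite -[x](addrK y).
by apply: idealB h _; exact: ys'.
Qed.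

Definition nonzerodivisor x := forall y, x * y = 0 -> y = 0.

Lemma ex_nonzerodivisor (noethR : noetherian R) I :
  (forall p y, (forall a, a \in p <-> a * y = 0) -> ~ {subset I <= p}) ->
  exists2 x : R, x \in I & nonzerodivisor x.
Proof.
move=> Iann; pose O : ideal R := span [set (0 : R^o)].
have inO a : a \in O <-> a = 0.
  by rewrite mem_span1; split=> [[c ->]|->]; [|exists 0]; rewrite mulr0.
have [s sP] := finite_colon_primes noethR O.
have [|x xI xs] := @prime_avoidance I [seq p : spec R <- s | `[< exists z, colon_prime O z p >]].
  move=> p; rewrite mem_filter => /andP[/asboolP[z zp] _].
  by apply: (Iann p z) => a; rewrite zp inO.
exists x => // y xy; apply: contrapT => y0.
have [|u [p up]] := @ex_colon_prime noethR O y; first by apply/negP => /inO.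
have /negP[] : x \notin p.
  by apply: xs; rewrite mem_filter (sP _ _ up) andbT; apply/asboolP; exists (u * y).
by apply/up/inO; rewrite mulrCA xy mulr0.
Qed.

End AssociatedPrimes.

(** * Suprema, heights and localization at a prime *)

Section Suprema.
Local Open Scope ereal_scope.

(** [supremum] picks a least upper bound if there is one, so one is exhibited: the maximum of a
    bounded set, [+oo] otherwise. *)
Lemma nat_supP (A : set nat) : (A !=set0)%classic ->
  supremums [set n%:Z%:E | n in A]%classic (nat_sup A).
Proof.
move=> A0; rewrite /nat_sup /supremum ifF; last first.
  by apply/negP => /eqP; have [n An] := A0; move/seteqP => [/(_ n%:Z%:E)+ _]; apply; exists n.
case: xgetP => // h; exfalso.
have [[k kA]|nA] := pselect (exists k, forall n, A n -> (n <= k)%N).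
  have exA : exists n, `[< A n >] by have [n An] := A0; exists n; apply/asboolP.
  have ubA n : `[< A n >] -> (n <= k)%N by move=> /asboolP; exact: kA.
  have [m /asboolP Am mA] := ex_maxnP exA ubA.
  apply: (h m%:Z%:E); split; last by move=> y; apply; exists m.
  by move=> _ [n An <-]; rewrite lee_fin lez_nat; apply/mA/asboolP.
apply: (h +oo); split=> [y _|[r||] yA]; rewrite ?leey //; exfalso.
  apply: nA; exists `|r|%N => n An.
  have /yA : [set n%:Z%:E | n in A]%classic n%:Z%:E by exists n.
  by rewrite lee_fin -lez_nat => /le_trans; apply; rewrite abszE ler_norm.
have [n An] := A0.
by have /yA : [set n%:Z%:E | n in A]%classic n%:Z%:E by exists n.
Qed.

Lemma nat_sup_ge (A : set nat) n : A n -> n%:Z%:E <= nat_sup A.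
Proof.
move=> An; have A0 : (A !=set0)%classic by exists n.
by apply: (nat_supP A0).1; exists n.
Qed.

Lemma nat_sup_le (A : set nat) k :
  (forall n, A n -> (n <= k)%N) -> nat_sup A <= k%:Z%:E.
Proof.
move=> Ak; have [->|/set0P A0] := eqVneq A set0%classic.
  by rewrite /nat_sup image_set0 supremum0 leNye.
by apply: (nat_supP A0).2 => _ [n An <-]; rewrite lee_fin lez_nat; exact: Ak.
Qed.

(** A minimal prime over [I] with nothing below it has height 0, and the infimum is then 0 since no
    prime has negative height. *)
Lemma height_gt0_prime (R : comPzRingType) (I : ideal R) (p : spec R) :
  0 < height I -> {subset I <= p} ->
  exists2 q : spec R, {subset q <= p} & ~ {subset p <= q}.
Proof.
move=> hI Ip; apply: contrapT => pmin.
have h0 (q : spec R) : 0 <= prime_height q.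
  by apply: nat_sup_ge; exists (fun=> q) => // i; rewrite ltn0.
have hp : prime_height p = 0.
  apply/eqP; rewrite eq_le h0 andbT; apply: nat_sup_le => -[//|n] [c cc cp].
  case: pmin; exists (c n); have [cn cnN] := cc n (ltnSn n).
    by move=> a /cn; rewrite cp.
  by move=> pn; apply: cnN => a; rewrite cp; exact: pn.
suff hI0 : height I = 0 by rewrite hI0 ltxx in hI.
have infI : infimums [set prime_height p | p in [set p : spec R | {subset I <= p}]]%classic 0.
  split=> [_ [q _ <-]|y]; first exact: h0.
  by apply; exists p.
rewrite /height /infimum ifF; last first.
  by apply/negP => /eqP/seteqP[/(_ 0)+ _]; apply; exists p.
case: xgetP => [y _ yinf|/(_ 0)//].
exact: is_subset1_infimums yinf infI.
Qed.

End Suprema.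

(** * Fractions, ideals and chains of primes in the local ring *)

Section LocalizationAtPrime.
Context (R : comPzRingType) (p : spec R).
Implicit Types (q : spec R) (a b x y : R) (J : ideal R).
Notation S := (prime_compl p).
Notation denom := {s : R | s \in S}.

Definition loc_frac a (s : denom) : local_ring p := frac (a : R^o) s.

Lemma denomP (s : denom) : sval s \notin p.
Proof. exact: (svalP s). Qed.

Lemma loc_fracP (z : local_ring p) :
  exists a (s : denom), z = loc_frac a s.
Proof. exact: fracP z. Qed.

Lemma loc_frac_eq a b (s t : denom) :
  (loc_frac a s = loc_frac b t) <->
  exists2 u : R, u \notin p & u * (sval t * a - sval s * b) = 0.
Proof. exact: (@frac_eq _ S R^o a s b t). Qed.

Lemma loc_frac_cong a b (s t : denom) : sval t * a = sval s * b ->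
  loc_frac a s = loc_frac b t.
Proof. exact: (@frac_cong _ S R^o). Qed.

Lemma loc_fracM a b (s t : denom) :
  loc_frac a s * loc_frac b t =
  loc_frac (a * b) (denM s t).
Proof. exact: (@loc_scaleE _ S R^o). Qed.

Lemma loc_fracD a b (s t : denom) :
  loc_frac a s + loc_frac b t =
  loc_frac (sval t * a + sval s * b) (denM s t).
Proof. exact: (@fracD _ S R^o). Qed.

Lemma loc0E : 0 = loc_frac 0 (den1 S).
Proof. by []. Qed.

Lemma loc1E : 1 = loc_frac 1 (den1 S).
Proof. by []. Qed.

Lemma loc_frac_eq0 a (s : denom) :
  (loc_frac a s = 0 :> local_ring p) <-> exists2 u : R, u \notin p & u * a = 0.
Proof.
rewrite loc0E loc_frac_eq /= mulr0 subr0 mul1r.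
by split=> -[u up ua]; exists u.
Qed.

(** Clears denominators. The induction over the span treats all fractions representing the element
    at once. *)
Lemma local_idealP J a (s : denom) :
  loc_frac a s \in local_ideal p J <->
  exists2 u : R, u \notin p & u * a \in J.
Proof.
split=> [|[u up uaJ]].
  suff h (z : local_ring p) : z \in local_ideal p J ->
      forall a (s : denom), z = loc_frac a s -> exists2 u : R, u \notin p & u * a \in J.
    by move=> /h; exact.
  move: z; apply: (@span_ind _ (local_ring p)^o) => [|z x y xP yP|_ [b bJ ->]] {}a {}s.
  - move=> /esym/loc_frac_eq0[u up ua]; exists u => //.
    by rewrite ua ideal0.
  - have [c [r ->]] := loc_fracP z; have [d [t]] := loc_fracP x.
    have [e [v]] := loc_fracP y => ye xd.
    have [u up udJ] := xP _ _ xd; have [w wp weJ] := yP _ _ ye; rewrite xd ye.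
    rewrite /GRing.scale /= -/(loc_mul _ _) loc_fracM loc_fracD => /loc_frac_eq[k kp /= kE].
    have k0 : k * sval s * (sval v * (c * d) + sval r * sval t * e) =
        k * (sval r * sval t * sval v) * a.
      by apply/eqP; rewrite -subr_eq0 -kE; apply/eqP; ring.
    exists (u * w * (k * (sval r * sval t * sval v))).
      by rewrite !prime_notinM // denomP.
    rewrite -mulrA -k0.
    have -> : u * w * (k * sval s * (sval v * (c * d) + sval r * sval t * e)) =
        (w * k * sval s * sval v * c) * (u * d) +
        (u * k * sval s * sval r * sval t) * (w * e) by ring.
    by apply: idealD; exact: idealMl.
  - move=> /esym/loc_frac_eq[u up /= /eqP]; rewrite mulrBr subr_eq0 mul1r => /eqP ua.
    by exists u => //; rewrite ua mulrCA; do 2!apply: idealMl.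
have us : u * sval s \in S by apply/prime_notinM/denomP.
have -> : loc_frac a s =
    loc_frac 1 (exist (fun x => x \in S) _ us) * to_loc S (u * a).
  by rewrite loc_fracM; apply: loc_frac_cong => /=; ring.
by apply: idealMl; apply: mem_span; exists (u * a).
Qed.

Lemma to_locP J a :
  (to_loc S a : local_ring p) \in local_ideal p J <-> exists2 u : R, u \notin p & u * a \in J.
Proof. exact: local_idealP. Qed.

Lemma local_ideal_prime a (s : denom) :
  (loc_frac a s \in local_ideal p p) = (a \in p).
Proof.
apply/idP/idP => [/local_idealP[u /negPf up /prime_mem_mul[]]|ap]; rewrite ?up //.
by apply/local_idealP; exists 1; rewrite ?mul1r ?prime_notin1.
Qed.

Lemma local_unit (z : local_ring p) : z \notin local_ideal p p -> exists w, w * z = 1.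
Proof.
have [a [s ->]] := loc_fracP z; rewrite local_ideal_prime => ap.
exists (loc_frac (sval s) (exist (fun x => x \in S) a ap)).
by rewrite loc_fracM loc1E; apply: loc_frac_cong => /=; ring.
Qed.

Lemma ex_local_prime q : {subset q <= p} ->
  exists Q : spec (local_ring p),
    forall a (s : denom), (loc_frac a s \in Q) = (a \in q).
Proof.
move=> qp.
have qE a (s : denom) :
    loc_frac a s \in local_ideal p q <-> a \in q.
  rewrite local_idealP; split=> [[u up /prime_mem_mul[/qp|//]]|aq].
    by rewrite (negPf up).
  by exists 1; rewrite ?mul1r ?prime_notin1.
have [||||Q QP] := @ex_spec (local_ring p) (fun z => z \in local_ideal p q).
- exact: ideal0.
- by move=> z x y xq yq; apply: idealD => //; exact: idealMl.
- by rewrite loc1E qE; apply/negP/prime_notin1.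
- move=> x y; have [a [s ->]] := loc_fracP x; have [b [t ->]] := loc_fracP y.
  by rewrite loc_fracM !qE; exact: prime_mem_mul.
by exists Q => a s; apply/idP/idP => [/QP/qE|/qE/QP].
Qed.

Lemma krull_dim_local_ge (c : nat -> spec R) n :
  prime_chain c n -> {subset c n <= p} -> (n%:Z%:E <= krull_dim (local_ring p))%E.
Proof.
move=> cc cnp; apply: nat_sup_ge.
have cp i : (i <= n)%N -> {subset c i <= p}.
  move=> /subnKC; move: (n - i)%N => k; elim: k i => [|k IH] i kn.
    by move: kn; rewrite addn0 => ->.
  have ilt : (i < n)%N by rewrite -kn -addSnnS leq_addr.
  by move=> a /(cc i ilt).1 /(IH i.+1 _); apply; rewrite addSnnS.
have /choice[C CP] : forall i, exists Q : spec (local_ring p), (i <= n)%N ->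
    forall a (s : denom), (loc_frac a s \in Q) = (a \in c i).
  move=> i; have [/cp/ex_local_prime[Q QP]|_] := leqP i n; first by exists Q.
  (* Beyond index [n] the chain is unconstrained; the prime coming from [p] itself is a filler. *)
  by have [Q _] := @ex_local_prime p (fun=> id); exists Q.
exists C => i ilt; have [ci ciN] := cc i ilt; split=> [z|Ci].
  by have [a [s ->]] := loc_fracP z; rewrite !CP // ?(ltnW ilt) //; exact: ci.
apply: ciN => a; have := Ci (loc_frac a (den1 S)).
by rewrite !CP // ltnW.
Qed.

End LocalizationAtPrime.

(** * Depth and Serre's condition *)

Section SerreCondition.
Context (R : comPzRingType).
Implicit Types (p q : spec R) (a b x y z : R).

Lemma span_nil (A : comPzRingType) (z : A) : z \in span [set` ([::] : seq A^o)]%classic -> z = 0.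
Proof.
move: z; apply: (@span_ind A A^o) => // a x y -> ->.
by rewrite scaler0 addr0.
Qed.

Lemma span_seq1 (A : comPzRingType) (a z : A) :
  z \in span [set` ([:: a] : seq A^o)]%classic <-> exists c, z = c * a.
Proof.
rewrite -mem_span1.
by have -> : [set` ([:: a] : seq A^o)]%classic = [set (a : A^o)]%classic
  by apply/seteqP; split=> [x|x ->] /=; rewrite inE // => /eqP.
Qed.

(** Every element of [p R_p] kills [y / 1], which is not 0, so a regular sequence has no first
    term. *)
Lemma depth_annihilator p y : (forall a, a \in p <-> a * y = 0) ->
  (depth (local_ideal p p) <= 0%:Z%:E)%E.
Proof.
move=> py; apply: nat_sup_le => n [s [[_ sreg] sm <-]].
case: s sreg sm => // z s sreg sm; exfalso.
have /span_nil/loc_frac_eq0[u /negP up uy] :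
    loc_frac y (den1 (prime_compl p)) \in span [set` ([::] : seq (local_ring p)^o)]%classic.
  have := sreg 0%N isT (loc_frac y (den1 _)); rewrite take0; apply.
  have /= := sm z (mem_head _ _); have [a [t ->]] := loc_fracP z.
  rewrite local_ideal_prime => /py ay.
  rewrite loc_fracM ay (_ : loc_frac 0 _ = 0) ?ideal0 //.
  by apply/loc_frac_eq0; exists 1; rewrite ?mulr0 ?prime_notin1.
by apply: up; apply/py.
Qed.

(* [m] is the colon [(x) : y], which remains associated to every ideal generated
   by a nonzerodivisor of [m]: no second element of [m] is regular. *)
Lemma no_regular_pair (A : comPzRingType) (x y a b c d : A) :
  nonzerodivisor x -> nonzerodivisor a -> a * y = x * c -> b * y = x * d ->
  (forall w, (exists e, b * w = e * a) -> exists e, w = e * a) ->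
  exists e, y = e * x.
Proof.
move=> xreg areg ay bd breg.
have bc : b * c = d * a.
  apply/eqP; rewrite -subr_eq0; apply/eqP/xreg.
  have -> : x * (b * c - d * a) = b * (x * c) - a * (x * d) by ring.
  by rewrite -ay -bd; ring.
have [|e ce] := breg c; first by exists d.
exists e; apply/eqP; rewrite -subr_eq0; apply/eqP/areg.
by rewrite mulrBr ay ce; ring.
Qed.

(** By [no_regular_pair], two regular terms would put [y / 1] into [x R_p], and then an element
    outside [p] would multiply [y] into [(x)]. *)
Lemma depth_colon_nonzerodivisor p x y : nonzerodivisor x ->
  colon_prime (span [set (x : R^o)]) y p -> (depth (local_ideal p p) <= 1%:Z%:E)%E.
Proof.
move=> xreg yp; apply: nat_sup_le => n [s [[_ sreg] sm <-]].
case: s sreg sm => [//|z [//|w s]] sreg sm; exfalso.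
pose X := loc_frac x (den1 (prime_compl p)); pose Y := loc_frac y (den1 (prime_compl p)).
have mY (v : local_ring p) : v \in local_ideal p p -> exists c, v * Y = X * c.
  have [a [t ->]] := loc_fracP v; rewrite local_ideal_prime => /yp/mem_span1[c ac].
  by exists (loc_frac c t); rewrite !loc_fracM ac; apply: loc_frac_cong => /=; ring.
have [|c zc] := mY z; first by apply: sm; exact: mem_head.
have [|d wd] := mY w; first by apply: sm; rewrite !inE eqxx orbT.
have [|v zv|v [e ve]|e] := no_regular_pair _ _ zc wd.
- move=> v; have [a [t ->]] := loc_fracP v.
  rewrite loc_fracM => /loc_frac_eq0[u up uxa]; apply/loc_frac_eq0.
  by exists u => //; apply: xreg; rewrite mulrCA.
- apply/span_nil; have := sreg 0%N isT v; rewrite take0; apply.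
  by have /= -> := zv; exact: ideal0.
- by apply/span_seq1; apply: (sreg 1%N isT v); apply/span_seq1; exists e.
have [b [t ->]] := loc_fracP e; rewrite loc_fracM => /loc_frac_eq[u /negP up /= uE].
have utp : u * sval t \notin p by apply/prime_notinM/denomP; exact/negP.
move/negP: utp; apply; apply/yp/mem_span1; exists (u * b).
apply/eqP; rewrite -subr_eq0 -[X in _ == X]uE; apply/eqP; ring.
Qed.

Hypothesis S2 : serre_condition 2 R.

(** Depth 0 and (S2) leave no room for a chain of length 1 below [p]. *)
Lemma serre_annihilator_prime p y : (forall a, a \in p <-> a * y = 0) ->
  forall q, {subset q <= p} -> {subset p <= q}.
Proof.
move=> py q qp; apply: contrapT => pq.
have chain : prime_chain (fun i => if i is 0 then q else p) 1 by case.
have dim := krull_dim_local_ge chain (fun a => id).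
have := le_trans (S2 p) (depth_annihilator py).
rewrite ge_min => /orP[//|/(le_trans dim)].
by [].
Qed.

(** Depth at most 1 and (S2) leave no room for a chain of length 2 below [p]. *)
Lemma serre_colon_prime p x y : nonzerodivisor x ->
  colon_prime (span [set (x : R^o)]) y p ->
  forall q q', {subset q <= q'} -> ~ {subset q' <= q} ->
    {subset q' <= p} -> {subset p <= q'}.
Proof.
move=> xreg yp q q' qq' q'q q'p; apply: contrapT => pq'.
have chain : prime_chain (fun i => if i is i'.+1 then if i' is 0 then q' else p else q) 2.
  by case=> [|[|]].
have dim := krull_dim_local_ge chain (fun a => id).
have := le_trans (S2 p) (depth_colon_nonzerodivisor xreg yp).
by rewrite ge_min => /orP[//|/(le_trans dim)].
Qed.

Lemma ex_nonzerodivisor_height_gt0 (noethR : noetherian R) (I : ideal R) :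
  (0 < height I)%E -> exists2 x : R, x \in I & nonzerodivisor x.
Proof.
move=> hI; apply: ex_nonzerodivisor => // p y py Ip.
have [q qp pq] := height_gt0_prime hI Ip.
exact/pq/(serre_annihilator_prime py).
Qed.

End SerreCondition.

(** * Tensor products *)

Section FreeModuleTheory.
Context (R : comPzRingType) (X : choiceType).
Notation F := (free_module R X).

Lemma free_linE a (v w : F) k : sval (a *: v + w) k = a * sval v k + sval w k.
Proof. by []. Qed.

Lemma free_basisE (k j : X) : sval (free_basis R k) j = if j == k then 1 else 0.
Proof. by []. Qed.

Lemma free_supp (v : F) : exists s : seq X, forall k, sval v k != 0 -> k \in s.
Proof.
have /asboolP/finite_seqP[s sE] := svalP v; exists s => k vk.
by have /seteqP[/(_ k) h _] := sE; exact: h.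
Qed.

Lemma free_ind (P : F -> Prop) :
  P 0 -> (forall a v w, P v -> P w -> P (a *: v + w)) ->
  (forall k, P (free_basis R k)) -> forall v, P v.
Proof.
move=> P0 PD Pe v; have [s] := free_supp v; elim: s v => [|k s IH] v vs.
  have -> : v = 0 by apply/val_inj/funext => k; apply/eqP/negPn/negP => /vs.
  exact: P0.
have vE : v = sval v k *: free_basis R k + ((- sval v k) *: free_basis R k + v).
  by rewrite addrA -scalerDl subrr scale0r add0r.
rewrite vE; apply: (PD) => //; apply: IH => j.
rewrite free_linE free_basisE; have [->|jk] := eqVneq j k.
  by rewrite mulr1 addNr eqxx.
by rewrite mulr0 add0r => /vs; rewrite inE (negPf jk).
Qed.

Lemma free_lift (P : lmodType R) (g : X -> P) : exists h : F -> P,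
  (forall a v w, h (a *: v + w) = a *: h v + h w) /\
  forall k, h (free_basis R k) = g k.
Proof.
(* By [hE], this finitely supported sum can be taken over any duplicate-free list covering the
   support, so two vectors can share a list. *)
pose h (v : F) := (\sum_(k \in [set: X]) sval v k *: g k)%classic.
have hE (v : F) (s : seq X) : uniq s -> (forall k, sval v k != 0 -> k \in s) ->
    h v = \sum_(k <- s) sval v k *: g k.
  move=> us vs; rewrite /h (fsbigE s) // => [|k _ ks].
    by apply: eq_bigl => k; rewrite in_setT.
  have /eqP -> : sval v k == 0 by apply: contraNT ks; exact: vs.
  by rewrite scale0r.
exists h; split=> [a v w|k].
  have [s vs] := free_supp v; have [t wt] := free_supp w.
  have us := undup_uniq (s ++ t).
  rewrite !(hE _ _ us) => [|k|k|k]; rewrite ?mem_undup ?mem_cat.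
  - rewrite scaler_sumr -big_split; apply: eq_bigr => k _.
    by rewrite /= scalerA -scalerDl.
  - by move=> /wt ->; rewrite orbT.
  - by move=> /vs ->.
  - rewrite free_linE => /negP h0; apply/negPn/negP; rewrite negb_or => /andP[ks kt].
    apply: h0; have /eqP -> : sval v k == 0 by apply: contraNT ks; exact: vs.
    have /eqP -> : sval w k == 0 by apply: contraNT kt; exact: wt.
    by rewrite mulr0 addr0.
rewrite (hE _ [:: k]) // => [|j]; first by rewrite big_seq1 free_basisE eqxx scale1r.
by rewrite free_basisE inE; apply: contraNT => /negPf ->.
Qed.

End FreeModuleTheory.

Section TensorTheory.
Context (R : comPzRingType) (M N : lmodType R).
Notation T := (tensor M N).
Notation rel := (@tensor_relations R M N).

Definition tens (m : M) (n : N) : T :=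
  quotient_proj (span rel) (free_basis R (m, n)).

Lemma projZ a (v : free_module R (M * N)%type) :
  quotient_proj (span rel) (a *: v) = a *: (quotient_proj (span rel) v : T).
Proof. exact/esym/quotient_scaleE. Qed.

Lemma tensDl m m' n : tens (m + m') n = tens m n + tens m' n.
Proof.
rewrite -[RHS]quotient_projD; apply/quotient_proj_eq/mem_span.
by do 3!left; exists m, m', n.
Qed.

Lemma tensZl a m n : tens (a *: m) n = a *: tens m n.
Proof.
rewrite -projZ; apply/quotient_proj_eq/mem_span.
by left; right; exists a, m, n.
Qed.

Lemma tensZr a m n : tens m (a *: n) = a *: tens m n.
Proof.
rewrite -projZ; apply/quotient_proj_eq/mem_span.
by right; exists a, m, n.
Qed.

Lemma tensor_ind (P : T -> Prop) :
  P 0 -> (forall a x y, P x -> P y -> P (a *: x + y)) ->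
  (forall m n, P (tens m n)) -> forall t, P t.
Proof.
move=> P0 PD Pt t; have [v ->] := quotient_projP t.
move: v; apply: free_ind => [|a v w Pv Pw|[m n]]; last exact: Pt.
  by have -> : quotient_proj (span rel) 0 = 0 :> T by rewrite -(scale0r 0) projZ scale0r.
by rewrite quotient_projD projZ; exact: PD.
Qed.

(** The linear extension to the free module kills the relations, so it can be evaluated on any
    representative. *)
Lemma tensor_lift (P : lmodType R) (B : M -> N -> P) :
  (forall a m m' n, B (a *: m + m') n = a *: B m n + B m' n) ->
  (forall a m n n', B m (a *: n + n') = a *: B m n + B m n') ->
  exists h : T -> P, (forall a x y, h (a *: x + y) = a *: h x + h y) /\
    forall m n, h (tens m n) = B m n.
Proof.
move=> Bl Br; have [h [hL he]] := free_lift (fun k : M * N => B k.1 k.2).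
have hD v w : h (v + w) = h v + h w by rewrite -[v]scale1r hL !scale1r.
have h0 : h 0 = 0 by apply: (@addrI _ (h 0)); rewrite -hD !addr0.
have hZ a v : h (a *: v) = a *: h v by rewrite -[a *: v]addr0 hL h0 addr0.
have hB v w : h (v - w) = h v - h w by rewrite hD -scaleN1r hZ scaleN1r.
have Bl0 n : B 0 n = 0.
  by apply: (@addrI _ (B 0 n)); have := Bl 1 0 0 n; rewrite !scale1r !addr0.
have Br0 m : B m 0 = 0.
  by apply: (@addrI _ (B m 0)); have := Br 1 m 0 0; rewrite !scale1r !addr0.
have hrel v : v \in span rel -> h v = 0.
  move: v; apply: span_ind => [//|a x y xE yE|y [[[|]|]|]].
  - by rewrite hL xE yE scaler0 addr0.
  - move=> [m [m' [n ->]]]; rewrite hB hD !he /=.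
    by have := Bl 1 m m' n; rewrite !scale1r => ->; rewrite subrr.
  - move=> [m [n [n' ->]]]; rewrite hB hD !he /=.
    by have := Br 1 m n n'; rewrite !scale1r => ->; rewrite subrr.
  - move=> [a [m [n ->]]]; rewrite hB hZ !he /=.
    by have := Bl a m 0 n; rewrite Bl0 !addr0 => ->; rewrite subrr.
  - move=> [a [m [n ->]]]; rewrite hB hZ !he /=.
    by have := Br a m n 0; rewrite Br0 !addr0 => ->; rewrite subrr.
pose H (t : T) : P := h (repr (t : Quotient.quot (subgroup_of (span rel)))).
have HE v : H (quotient_proj (span rel) v) = h v.
  apply/eqP; rewrite -subr_eq0 -hB; apply/eqP/hrel.
  by apply/quotient_proj_eq; rewrite /quotient_proj reprK.
exists H; split=> [a x y|m n]; last by rewrite HE he.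
have [v ->] := quotient_projP x; have [w ->] := quotient_projP y.
by rewrite -projZ -quotient_projD !HE hL.
Qed.

End TensorTheory.

(** * Discrete valuation rings *)

Section Uniformizer.
Context (R : comPzRingType) (p : spec R).
Implicit Types (a b c e s t u : R) (I J : ideal R).
Notation m := (local_ideal p p).

(* [t/1] is a nonzerodivisor generating the maximal ideal of [R_p], with
   denominators cleared. *)
Definition uniformizer t := [/\ t \in p,
  forall b, b \in p -> exists s c, s \notin p /\ s * b = c * t &
  forall c, c * t = 0 -> exists s, s \notin p /\ s * c = 0].

Lemma uniformizerX t n c : uniformizer t -> c * t ^+ n = 0 ->
  exists s, s \notin p /\ s * c = 0.
Proof.
move=> [_ _ treg]; elim: n c => [|n IH] c.
  by rewrite mulr1 => ->; exists 1; rewrite mulr0 prime_notin1.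
rewrite exprS mulrA => /IH[s [sp sct]].
have [s' [s'p s'sc]] : exists s', s' \notin p /\ s' * (s * c) = 0.
  by apply: treg; rewrite -mulrA.
by exists (s' * s); rewrite -mulrA prime_notinM.
Qed.

(** Krull's intersection argument: if every [t ^+ n] divides [a] at [p], the ascending ideals
    [(a : t ^+ n)] stop, which makes [a] a multiple of [t * a] at [p]; as [t] is in [p], an element
    outside [p] then kills [a]. *)
Lemma uniformizer_krull (noethR : noetherian R) t a : uniformizer t ->
  (forall s, s \notin p -> s * a <> 0) ->
  exists n s s', [/\ s \notin p, s' \notin p & s * a = s' * t ^+ n].
Proof.
move=> [tp tgen treg] a0; apply: contrapT => h.
have divt n : exists s c, s \notin p /\ s * a = c * t ^+ n.
  elim: n => [|n [s [c [sp sac]]]].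
    by exists 1, a; rewrite mulr1 mul1r prime_notin1.
  have [cp|cp] := boolP (c \in p); last by case: h; exists n, s, c.
  have [s' [c' [s'p s'c]]] := tgen c cp.
  by exists (s' * s), c'; rewrite prime_notinM // -mulrA sac mulrA s'c exprS mulrA.
have /choice[C CP] : forall n, exists J : ideal R, forall c,
    c \in J <-> exists s e, s \notin p /\ s * (c * t ^+ n) = e * a.
  move=> n; apply: ex_ideal => [|c x y [s [e [sp se]]] [r [d [rp rd]]]].
    by exists 1, 0; rewrite !mul0r mulr0 prime_notin1.
  exists (r * s), (r * c * e + s * d); rewrite prime_notinM //; split=> //.
  have -> : r * s * ((c * x + y) * t ^+ n) =
    r * c * (s * (x * t ^+ n)) + s * (r * (y * t ^+ n)) by ring.
  by rewrite se rd; ring.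
have [n c nP|n nP] := ideal_acc noethR (c := C).
  apply/CP; have [s [e [sp se]]] := (CP _ _).1 nP.
  by exists s, (e * t); rewrite exprS -mulrAC -se; split=> //; ring.
have [s [c [sp sac]]] := divt n.+1.
have /nP/CP[s' [e [s'p s'e]]] : c \in C n.+1.
  by apply/CP; exists 1, s; rewrite mul1r prime_notin1.
apply: (a0 (s' * s - e * t)).
  apply/negP => h'; have /negP[] : s' * s \notin p by exact: prime_notinM.
  by rewrite -(subrK (e * t) (s' * s)); apply: idealD h' _; exact: idealMl.
have -> : (s' * s - e * t) * a = s' * (s * a) - (e * a) * t by ring.
by rewrite -s'e sac exprS; ring.
Qed.

Lemma local_ideal_proper : (1 : local_ring p) \notin m.
Proof. by rewrite loc1E local_ideal_prime prime_notin1. Qed.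

Lemma local_maximal : maximal_ideal m.
Proof.
split=> [|J mJ J1 z zJ]; first exact: local_ideal_proper.
apply/negPn/negP => /local_unit[w wz]; move/negP: J1; apply.
by rewrite -wz; exact: idealMl.
Qed.

Lemma local_maximal_unique (m' : ideal (local_ring p)) : maximal_ideal m' -> m' =i m.
Proof.
move=> [m'1 m'max].
have m'm : {subset m' <= m}.
  move=> z zm'; apply/negPn/negP => /local_unit[w wz]; move/negP: m'1; apply.
  by rewrite -wz; exact: idealMl.
move=> z; apply/idP/idP; first exact: m'm.
exact: (m'max m m'm local_ideal_proper).
Qed.

(** The numerator of a generator of the maximal ideal serves; it is regular because [R_p] is a
    domain and not a field. *)
Lemma dvr_uniformizer :
  discrete_valuation_ring (local_ring p) -> exists t, uniformizer t.
Proof.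
move=> [_ dom pid [m' [m'max [a am a0] _]]].
have m'E := local_maximal_unique m'max; rewrite m'E in am.
have [z zP] := pid m; have [t [s zE]] := loc_fracP z.
have mP (w : local_ring p) : w \in m <-> exists c : local_ring p, w = c * z.
  by rewrite zP; exact: mem_span1.
exists t; split.
- by rewrite -(local_ideal_prime t s) -zE; apply/mP; exists 1; rewrite mul1r.
- move=> b; rewrite -(local_ideal_prime b (den1 _)) => /mP[c].
  have [d [r ->]] := loc_fracP c; rewrite zE loc_fracM => /loc_frac_eq[u up /= /eqP].
  rewrite mulrBr subr_eq0 mul1r => /eqP ub.
  exists (u * (sval r * sval s)), (u * d); split; last by rewrite -mulrA ub mulrA.
  by rewrite !prime_notinM ?denomP.
- move=> c ct; have : loc_frac c (den1 _) * z = 0.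
    by rewrite zE loc_fracM ct; apply/loc_frac_eq0; exists 1; rewrite ?mulr0 ?prime_notin1.
  move=> /dom[/loc_frac_eq0[u up uc]|z0]; first by exists u.
  by move/eqP: a0; case; have [d ->] := (mP a).1 am; rewrite z0 mulr0.
Qed.

(** By [krull], each nonzero element and some power of [T] divide each other. No power of [T] is 0,
    and a nonzero ideal is generated by the least power it contains. *)
Lemma uniformizer_dvr (noethR : noetherian R) t :
  uniformizer t -> discrete_valuation_ring (local_ring p).
Proof.
move=> tunif; have [tp tgen treg] := tunif.
pose T : local_ring p := loc_frac t (den1 _).
have TX n : T ^+ n = loc_frac (t ^+ n) (den1 _).
  elim: n => [//|n IH]; rewrite exprS IH loc_fracM -exprS.
  by apply: loc_frac_cong => /=; ring.
have krull (z : local_ring p) : z <> 0 ->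
    exists n (w w' : local_ring p), z = w * T ^+ n /\ T ^+ n = w' * z.
  have [a [s ->]] := loc_fracP z => a0.
  have [r rp ra|n [r [r' [rp r'p ra]]]] := uniformizer_krull noethR (a := a) tunif.
    by apply: a0; apply/loc_frac_eq0; exists r.
  have rsp : r * sval s \in prime_compl p by apply/prime_notinM/denomP.
  exists n, (loc_frac r' (exist (fun x => x \in prime_compl p) _ rsp)).
  exists (loc_frac (r * sval s) (exist (fun x => x \in prime_compl p) r' r'p)).
  rewrite TX !loc_fracM; split; apply: loc_frac_cong => /=.
    by rewrite -ra; ring.
  have -> : r * sval s * a = sval s * (r * a) by ring.
  by rewrite ra; ring.
split.
- apply/eqP; rewrite loc1E => /loc_frac_eq0[u /negP up].
  by rewrite mulr1 => u0; apply: up; rewrite u0; exact: ideal0.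
- move=> z w zw; apply: contrapT => /not_orP[/krull[n [_ [z' [_ zn]]]] /krull[k [_ [w' [_ wk]]]]].
  have : T ^+ (n + k) = 0 by rewrite exprD zn wk mulrACA zw mulr0.
  rewrite TX => /loc_frac_eq0[u up /(uniformizerX tunif)[s [sp su]]].
  have /negP[] : s * u \notin p by exact: prime_notinM.
  by rewrite su ideal0.
- move=> J; have [J0|/existsNP[z /not_implyP[zJ /krull[n [_ [w [_ zn]]]]]]] :=
    pselect (forall z : local_ring p, z \in J -> z = 0).
    exists 0 => z; apply/idP/idP => [/J0 ->|/mem_span1[c ->]]; first exact: ideal0.
    by rewrite mulr0 ideal0.
  have exJ : exists n, T ^+ n \in J by exists n; rewrite zn; exact: idealMl.
  have [k kJ kmin] := ex_minnP exJ; exists (T ^+ k) => y.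
  apply/idP/idP => [yJ|/mem_span1[c ->]]; last exact: idealMl.
  have [->|/eqP/krull[l [v [v' [yl ly]]]]] := eqVneq y 0; first exact: ideal0.
  rewrite yl; apply/mem_span1; exists (v * T ^+ (l - k)).
  by rewrite -mulrA -exprD subnK // kmin // ly; exact: idealMl.
- exists m; split; [exact: local_maximal| |exact: local_maximal_unique].
  exists T; first by rewrite local_ideal_prime.
  apply/eqP => /loc_frac_eq0[u up /treg[s [sp su]]].
  have /negP[] : s * u \notin p by exact: prime_notinM.
  by rewrite su ideal0.
Qed.

End Uniformizer.

(** * Integral closure and the determinant trick *)

Section IntegralClosure.
Context (R : comPzRingType).
Implicit Types (a b c d e h s t u w x y z : R) (I J L : ideal R) (p q : spec R).

Lemma ideal_mul_mem I J a b : a \in I -> b \in J -> a * b \in ideal_mul I J.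
Proof. by move=> aI bJ; apply: mem_span; exists a, b. Qed.

Lemma ideal_mul_ind I J (P : R -> Prop) : P 0 ->
  (forall x y, P x -> P y -> P (x + y)) ->
  (forall a b, a \in I -> b \in J -> P (a * b)) -> forall x, x \in ideal_mul I J -> P x.
Proof.
(* Proving [P] for all multiples of [x] absorbs the scalars in [span_ind]. *)
move=> P0 PD PM x; suff : x \in ideal_mul I J -> forall c, P (c * x).
  by move=> h /h/(_ 1); rewrite mul1r.
move: x; apply: (@span_ind R R^o) => [c|a x y xP yP c|_ [a [b [aI bJ ->]]] c].
- by rewrite mulr0.
- by rewrite mulrDr; apply: PD; [rewrite mulrA; exact: xP|exact: yP].
- by rewrite mulrA; apply: PM => //; exact: idealMl.
Qed.

Lemma ideal_pow0 I x : x \in ideal_pow I 0.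
Proof. by rewrite -[x]mulr1; apply/idealMl/mem_span. Qed.

Lemma ideal_powX I a n : a \in I -> a ^+ n \in ideal_pow I n.
Proof.
move=> aI; elim: n => [|n IH]; first exact: ideal_pow0.
by rewrite exprS; exact: ideal_mul_mem.
Qed.

Lemma ideal_pow_mul I m n x y :
  x \in ideal_pow I m -> y \in ideal_pow I n -> x * y \in ideal_pow I (m + n).
Proof.
move=> + yI; elim: m x => [|m IH] x; first by move=> _; exact: idealMl.
move: x; apply: ideal_mul_ind => [|x x' xP xP'|a b aI bI].
- by rewrite mul0r ideal0.
- by rewrite mulrDl; exact: idealD.
- by rewrite -mulrA; apply: ideal_mul_mem => //; exact: IH.
Qed.

Lemma ideal_pow_prod I n (F : 'I_n -> R) :
  (forall i, F i \in I) -> \prod_i F i \in ideal_pow I n.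
Proof.
elim: n F => [|n IH] F FI; first exact: ideal_pow0.
by rewrite big_ord_recl; apply: ideal_mul_mem => //; exact: IH.
Qed.

Lemma ideal_pow_sub I n : {subset ideal_pow I n.+1 <= I}.
Proof.
apply: ideal_mul_ind => [|x y|a b aI _]; [exact: ideal0|exact: idealD|exact: idealMr].
Qed.

(** The ideal is [I + R z]. *)
Lemma ex_adjoin I z : exists J : ideal R,
  [/\ {subset I <= J}, z \in J & forall x, x \in J -> exists c, x - c * z \in I].
Proof.
have [||J JP] := @ex_ideal _ (fun x => exists c, x - c * z \in I).
- by exists 0; rewrite mul0r subr0 ideal0.
- move=> a x y [c xc] [d yd]; exists (a * c + d).
  have -> : a * x + y - (a * c + d) * z = a * (x - c * z) + (y - d * z) by ring.
  by apply/idealD/yd/idealMl.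
exists J; split=> [x xI||x /JP //]; apply/JP; last by exists 1; rewrite mul1r subrr ideal0.
by exists 0; rewrite mul0r subr0.
Qed.

Lemma adjoin_pow I J z n x :
  (forall x, x \in J -> exists c, x - c * z \in I) -> x \in ideal_pow J n ->
  exists2 e : nat -> R, (forall i, (i <= n)%N -> e i \in ideal_pow I (n - i)) &
    x = \sum_(i < n.+1) e i * z ^+ i.
Proof.
move=> JP; elim: n x => [|n IH] x.
  move=> _; exists (fun=> x) => [i|]; first by rewrite leqn0 => /eqP->; exact: ideal_pow0.
  by rewrite big_ord1 mulr1.
move: x; apply: ideal_mul_ind => [|x y [d dI ->] [e eI ->]|a b /JP[c ac] /IH[e eI ->]].
- exists (fun=> 0) => [i _|]; first exact: ideal0.
  by rewrite big1 // => i _; rewrite mul0r.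
- exists (fun i => d i + e i) => [i ilt|]; first by apply: idealD; [exact: dI|exact: eI].
  by rewrite -big_split /=; apply: eq_bigr => i _; rewrite mulrDl.
(* In [a = (a - c z) + c z], the first summand multiplies coefficients by an element of [I] and the
   second shifts degrees. The test cuts off [e n.+1], about which nothing is known. *)
exists (fun i => (if (i <= n)%N then (a - c * z) * e i else 0) +
                 (if i is i'.+1 then c * e i' else 0)) => [i ilt|].
  apply: idealD.
    case: ifP => [ile|_]; last exact: ideal0.
    by rewrite subSn //; apply: ideal_mul_mem => //; exact: eI.
  case: i ilt => [_|i]; first exact: ideal0.
  by rewrite subSS ltnS => ile; apply/idealMl/eI.
under [RHS]eq_bigr => i _ do rewrite mulrDl.
rewrite [RHS]big_split /= [X in _ = X + _]big_ord_recr /= ltnn mul0r addr0.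
rewrite [X in _ = _ + X]big_ord_recl /= mul0r add0r.
rewrite mulr_sumr -big_split; apply: eq_bigr => i _ /=.
rewrite -ltnS ltn_ord /bump /= add1n exprS; ring.
Qed.

(* Multiplying by [s ^+ n] the equation exhibits [s * z] as integral over [I]. *)
Lemma integral_criterion I J z s h n : integrally_closed I ->
  (forall x, x \in J -> exists c, x - c * z \in I) ->
  h \in ideal_mul I (ideal_pow J n) -> s * z ^+ n.+1 + h = 0 -> s * z \in I.
Proof.
move=> Iic JP hI eqn.
have [e eI hE] : exists2 e : nat -> R,
    (forall i, (i <= n)%N -> e i \in ideal_pow I (n.+1 - i)) &
    h = \sum_(i < n.+1) e i * z ^+ i.
  move: h hI {eqn}; apply: ideal_mul_ind => [|x y [d dI ->] [e eI ->]|a b aI].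
  - exists (fun=> 0) => [i _|]; first exact: ideal0.
    by rewrite big1 // => i _; rewrite mul0r.
  - exists (fun i => d i + e i) => [i ilt|]; first by apply: idealD; [exact: dI|exact: eI].
    by rewrite -big_split /=; apply: eq_bigr => i _; rewrite mulrDl.
  move=> /(adjoin_pow JP)[e eI ->]; exists (fun i => a * e i) => [i ilt|].
    by rewrite subSn //; apply: ideal_mul_mem => //; exact: eI.
  by rewrite mulr_sumr; apply: eq_bigr => i _; rewrite mulrA.
suff : integral_closure I (s * z) by rewrite Iic.
(* With [k = n + 1 - i], the term [s ^+ n * e k * z ^+ k] equals
   [s ^+ (i - 1) * e k * (s * z) ^+ k], and [e k] is in the [i]-th power of [I]. *)
exists n.+1, (fun i => s ^+ i.-1 * e (n.+1 - i)%N); split=> // [i /andP[i0 ilt]|].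
  apply: idealMl; rewrite -[X in ideal_pow I X](subKn ilt); apply: eI.
  by rewrite -ltnS; move: i0 ilt; case: i => // i _ _; rewrite subSS ltnS leq_subr.
rewrite big_add1 big_mkord.
transitivity (s ^+ n * (s * z ^+ n.+1 + h)); last by rewrite eqn mulr0.
rewrite mulrDr hE mulr_sumr; congr (_ + _).
  by rewrite exprMn mulrA -exprSr.
rewrite [RHS](reindex_inj rev_ord_inj); apply: eq_bigr => i _ /=.
rewrite subSS exprMn.
have -> : s ^+ n = s ^+ i * s ^+ (n - i) by rewrite -exprD subnKC // -ltnS.
ring.
Qed.

(** A permutation other than the identity meets an off-diagonal entry, which is in [I], and its
    other [n] factors are in [J]. The identity contributes the product treated by [gen]. *)
Lemma det_adjoin I J n (B : 'M[R]_n.+1) z : {subset I <= J} -> z \in J ->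
  (forall i j, B i j \in I) ->
  \det (z%:M - B) - z ^+ n.+1 \in ideal_mul I (ideal_pow J n).
Proof.
move=> IJ zJ BI; rewrite /determinant (bigD1 1%g) //=.
rewrite odd_perm1 expr0 mul1r addrAC; apply: idealD; last first.
  apply: ideal_sum => sigma sigma1; apply: idealMl.
  have [i0 si0] : exists i, sigma i != i.
    apply/existsP; apply: contraNT sigma1; rewrite negb_exists => /forallP h.
    by apply/eqP/perm.permP => i; rewrite perm1; apply/eqP/negPn/h.
  rewrite (bigD1_ord i0) //=; apply: ideal_mul_mem.
    by rewrite !mxE eq_sym (negPf si0) sub0r -mulN1r; exact: idealMl.
  apply: ideal_pow_prod => i; rewrite !mxE; apply: idealB (IJ _ (BI _ _)).
  by rewrite -mulr_natr; exact: idealMr.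
have gen k (b : 'I_k -> R) : (forall i, b i \in I) ->
    \prod_i (z - b i) - z ^+ k \in ideal_mul I (ideal_pow J k.-1).
  elim: k b => [|k IH] b bI; first by rewrite big_ord0 subrr ideal0.
  rewrite big_ord_recl exprS.
  set P := \prod_(_ < _) _; have := IH (fun i => b (lift ord0 i)) (fun i => bI _).
  rewrite -/P => hP.
  have -> : (z - b ord0) * P - z * z ^+ k =
    z * (P - z ^+ k) - b ord0 * P by ring.
  apply: idealB; last first.
    apply: ideal_mul_mem => //; apply: ideal_pow_prod => i.
    exact: idealB (IJ _ (bI _)).
  clearbody P; clear IH b bI; case: k P hP => [|k] /= P hP; first exact: idealMl.
  move: hP; move: (_ - _); apply: ideal_mul_ind => [|x y xP yP|a c aI cJ].
  - by rewrite mulr0 ideal0.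
  - by rewrite mulrDr; exact: idealD.
  - by rewrite mulrCA; apply: ideal_mul_mem => //; exact: ideal_mul_mem.
under eq_bigr => i _ do rewrite perm1 !mxE eqxx mulr1n.
exact: gen.
Qed.

(** Multiplication by [z] acts on generators of [L] through a matrix [B] over [I]; by the adjugate,
    the determinant of [z - B] kills [L]. *)
Lemma determinant_trick I J L z (noethR : noetherian R) :
  {subset I <= J} -> z \in J -> (forall l, l \in L -> z * l \in ideal_mul I L) ->
  exists n h, h \in ideal_mul I (ideal_pow J n) /\
    forall l, l \in L -> (z ^+ n.+1 + h) * l = 0.
Proof.
move=> IJ zJ zL; have [n [f [fL gL]]] := fg_ideal noethR L.
(* A zero generator is put in front so that the matrix has positive size. *)
pose f0 (i : 'I_n.+1) := if unlift ord0 i is Some j then f j else 0.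
have f0L i : f0 i \in L by rewrite /f0; case: unliftP => // _; exact: ideal0.
have gen0 l : l \in L -> exists c : 'I_n.+1 -> R, l = \sum_i c i * f0 i.
  move=> /gL[c ->]; exists (fun i => if unlift ord0 i is Some j then c j else 0).
  rewrite [RHS]big_ord_recl /f0 unlift_none mulr0 add0r.
  by apply: eq_bigr => i _; rewrite liftK.
have /choice[B BP] : forall i, exists b : 'I_n.+1 -> R,
    (forall j, b j \in I) /\ z * f0 i = \sum_j b j * f0 j.
  move=> i; have := zL _ (f0L i); move: (z * f0 i).
  apply: ideal_mul_ind => [|x y [b [bI ->]] [c [cI ->]]|a l aI /gen0[c ->]].
  - by exists (fun=> 0); split=> [j|]; rewrite ?ideal0 // big1 // => j _; rewrite mul0r.
  - exists (fun j => b j + c j); split=> [j|]; first exact: idealD.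
    by rewrite -big_split /=; apply: eq_bigr => j _; rewrite mulrDl.
  - exists (fun j => a * c j); split=> [j|]; first exact: idealMr.
    by rewrite mulr_sumr; apply: eq_bigr => j _; rewrite mulrA.
pose D : 'M[R]_n.+1 := z%:M - \matrix_(i, j) B i j.
pose v : 'cV[R]_n.+1 := \col_i f0 i.
have Dv : D *m v = 0.
  apply/matrixP => i k; rewrite mulmxBl mul_scalar_mx !mxE (BP i).2.
  by apply/eqP; rewrite subr_eq0; apply/eqP/eq_bigr => j _; rewrite !mxE.
exists n, (\det D - z ^+ n.+1); split=> [|l /gen0[c ->]].
  by apply: det_adjoin => // i j; rewrite mxE (BP i).1.
have df i : \det D * f0 i = 0.
  have /matrixP/(_ i ord0) : (\det D)%:M *m v = 0.
    by rewrite -mul_adj_mx -mulmxA Dv mulmx0.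
  by rewrite mul_scalar_mx !mxE.
rewrite addrC subrK mulr_sumr big1 // => i _.
by rewrite mulrCA df mulr0.
Qed.

(** This joins two monic expressions in [z] that kill different elements into one of the same
    shape. *)
Lemma adjoin_monic_mul I J z m n g h : {subset I <= J} -> z \in J ->
  g \in ideal_mul I (ideal_pow J m) -> h \in ideal_mul I (ideal_pow J n) ->
  exists2 k : R, k \in ideal_mul I (ideal_pow J (m + n).+1) &
    (z ^+ m.+1 + g) * (z ^+ n.+1 + h) = z ^+ (m + n).+2 + k.
Proof.
move=> IJ zJ gI hI.
have mulI k l x y : x \in ideal_mul I (ideal_pow J k) -> y \in ideal_pow J l ->
    x * y \in ideal_mul I (ideal_pow J (k + l)).
  move=> + yJ; move: x; apply: ideal_mul_ind => [|x x' xP xP'|a b aI bJ].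
  - by rewrite mul0r ideal0.
  - by rewrite mulrDl; exact: idealD.
  - by rewrite -mulrA; apply: ideal_mul_mem => //; exact: ideal_pow_mul.
have hJ : h \in ideal_pow J n.+1.
  move: h hI; apply: ideal_mul_ind => [|x y|a b aI bJ]; [exact: ideal0|exact: idealD|].
  by apply: ideal_mul_mem => //; exact: IJ.
exists (g * (z ^+ n.+1 + h) + h * z ^+ m.+1).
  apply: idealD.
    rewrite -addnS; apply: mulI => //; apply: idealD => //.
    exact: ideal_powX.
  by rewrite addnC -addnS; apply: mulI => //; exact: ideal_powX.
rewrite -addSn -addnS exprD; ring.
Qed.

End IntegralClosure.

(** * Locally principal ideals *)

Section LocallyPrincipal.
Context (R : comPzRingType).
Implicit Types (a b c d e f s t u w x y z : R) (I J : ideal R) (p q : spec R).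

(* [a/1] is a nonzerodivisor generating [I R_p], with denominators cleared. *)
Definition local_generator I p a s := [/\ a \in I, s \notin p,
  forall b, b \in I -> exists c, s * b = c * a & forall c, c * a = 0 -> c * s = 0].

Lemma local_generator_uniformizer (noethR : noetherian R) I p y a s :
  integrally_closed I -> local_generator I p a s -> colon_prime I y p ->
  exists t, uniformizer p t.
Proof.
move=> Iic [aI sp agen areg] yp.
have /choice[g gP] : forall b, exists c, b \in p -> s * (b * y) = c * a.
  move=> b; have [/yp/agen[c cE]|_] := boolP (b \in p); last by exists 0.
  by exists c.
(* If [g b] is outside [p], then [b * y] is a unit multiple of [a] at [p]. So [b] is regular there,
   and comparing [c * y] with [b * y] for [c] in [p] shows that [b] generates. *)
have [[b bp dp]|h] := pselect (exists2 b : R, b \in p & g b \notin p).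
  have reg c : c * (b * y) = 0 -> g b * s * c = 0.
    move=> cby; have -> : g b * s * c = g b * c * s by ring.
    apply: areg; have -> : g b * c * a = c * (g b * a) by ring.
    by rewrite -gP // mulrCA cby mulr0.
  exists b; split=> // [c cp|c cb]; last first.
    by exists (g b * s); rewrite reg ?mulrA ?cb ?mul0r // prime_notinM.
  exists (g b * s * (g b * s)), (g b * s * (g c * s)).
  rewrite !prime_notinM //; split=> //.
  apply/eqP; rewrite -subr_eq0 -mulrA -[X in _ - X]mulrA -mulrBr; apply/eqP/reg.
  have -> : (g b * s * c - g c * s * b) * (b * y) =
    (g b * (s * (c * y)) - g c * (s * (b * y))) * b by ring.
  by rewrite !gP //; ring.
have {h}gp b : b \in p -> g b \in p.
  by move=> bp; apply/negPn/negP => gbp; apply: h; exists b.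
have ap : a \in p := colon_prime_sub yp aI.
(* Informally [b n] is [a * (s * y / a) ^+ n], as [bE] states without division. *)
pose b n := iter n g a.
have bp n : b n \in p by elim: n => //= n; exact: gp.
have bE n : a ^+ n * b n = s ^+ n * y ^+ n * a.
  elim: n => [|n IH]; first by rewrite !mul1r.
  rewrite exprSr -mulrA (mulrC a) -gP //.
  have -> : a ^+ n * (s * (b n * y)) = s * y * (a ^+ n * b n) by ring.
  by rewrite IH !exprS; ring.
have /choice[C CP] : forall n, exists J : ideal R, forall x,
    x \in J <-> exists c : nat -> R, x = \sum_(i < n) c i * b i.
  move=> n; apply: ex_ideal => [|e x x' [c ->] [d ->]].
    by exists (fun=> 0); rewrite big1 // => i _; rewrite mul0r.
  exists (fun i => e * c i + d i); rewrite mulr_sumr -big_split /=.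
  by apply: eq_bigr => i _; rewrite mulrDl mulrA.
(* The ideals [(b 0, ..., b n)] become stationary. The relation for [b n.+1], multiplied by
   [a ^+ n.+1], has a factor [a] that cancels at the cost of an [s]; this is an equation of
   dependence for [y]. *)
have [n x /CP[c ->]|n nP] := ideal_acc noethR (c := fun n => C n.+1).
  apply/CP; exists (fun i => if (i < n.+1)%N then c i else 0).
  rewrite [RHS]big_ord_recr /= ltnn mul0r addr0.
  by apply: eq_bigr => i _; rewrite ltn_ord.
have /nP/CP[c cE] : b n.+1 \in C n.+2.
  apply/CP; exists (fun i => if i == n.+1 then 1 else 0).
  rewrite big_ord_recr /= eqxx mul1r big1 ?add0r // => i _.
  by rewrite ltn_eqF ?mul0r.
have [J [IJ yJ JP]] := ex_adjoin I y.
have /negP[] : s ^+ n.+2 \notin p by exact: prime_notinX.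
apply/yp/(integral_criterion (n := n) (J := J)
  (h := - (s * \sum_(i < n.+1) c i * s ^+ i * (a ^+ (n.+1 - i) * y ^+ i)))) => //.
  rewrite -mulN1r; apply/idealMl/idealMl; apply: ideal_sum => i _; apply: idealMl.
  rewrite subSn -1?ltnS // exprS -mulrA; apply: ideal_mul_mem => //.
  move: (nat_of_ord i) (ltn_ord i) => k kn.
  have {2}-> : n = (n - k + k)%N by rewrite subnK // -ltnS.
  by apply: ideal_pow_mul; apply: ideal_powX => //; exact: IJ.
rewrite exprS -mulrA -mulrBr mulrC; apply: areg.
rewrite mulrBl -bE cE mulr_sumr mulr_suml -sumrB big1 // => i _.
have -> : a ^+ n.+1 = a ^+ (n.+1 - i) * a ^+ i by rewrite -exprD subnK // ltnW.
have -> : a ^+ (n.+1 - i) * a ^+ i * (c i * b i) =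
  c i * a ^+ (n.+1 - i) * (a ^+ i * b i) by ring.
by rewrite bE; ring.
Qed.

Lemma local_pow J p a n x :
  (forall b, b \in J -> exists s c, s \notin p /\ s * b = c * a) ->
  x \in ideal_pow J n -> exists s c, s \notin p /\ s * x = c * a ^+ n.
Proof.
move=> agen; elim: n x => [|n IH] x.
  by move=> _; exists 1, x; rewrite mul1r mulr1 prime_notin1.
move: x; apply: ideal_mul_ind => [|x y [s [c [sp sx]]] [s' [d [s'p sy]]]|b x bJ /IH].
- by exists 1, 0; rewrite mul0r mulr0 prime_notin1.
- exists (s * s'), (s' * c + s * d); rewrite prime_notinM //; split=> //.
  rewrite mulrDl -!mulrA -sx -sy; ring.
- move=> [s [c [sp sx]]]; have [s' [d [s'p sb]]] := agen b bJ.
  exists (s' * s), (d * c); rewrite prime_notinM //; split=> //.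
  by rewrite mulrACA sb sx exprS; ring.
Qed.

Lemma local_generatorP I p a s : local_generator I p a s ->
  forall b, b \in I -> exists s c, s \notin p /\ s * b = c * a.
Proof. by move=> [_ sp agen _] b /agen[c sb]; exists s, c. Qed.

Lemma uniformizer_integrally_closed (noethR : noetherian R) I :
  (forall p, exists a s, local_generator I p a s) ->
  (forall z p, colon_prime I z p -> exists t, uniformizer p t) ->
  integrally_closed I.
Proof.
move=> Ilg Iunif; apply/seteqP; split=> [x [n [a [n0 aI xE]]]|x xI]; last first.
  exists 1%N, (fun=> - x); split=> // [[|[|i]] // _|].
    rewrite -[- x]mulr1 -mulN1r -mulrA; apply: idealMl.
    exact: ideal_mul_mem (ideal_pow0 I 1).
  by rewrite big_nat1 subnn mulr1 subrr.
apply: contrapT => /negP/(ex_colon_prime noethR)[u [p zp]].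
have [t tunif] := Iunif _ p zp; have [tp tgen treg] := tunif.
have [g [s lg]] := Ilg p; have [gI sp ggen greg] := lg.
set z := u * x in zp; have [e se] := ggen _ ((zp t).1 tp).
(* If [t] divided [e] at [p], cancelling [t] in [s * (t * z) = e * g] would put [z] in [I] at [p].
   So [t * z] generates [I] at [p], and [z] is regular there. *)
have ep : e \notin p.
  apply/negP => /tgen[r [e' [rp re]]].
  have : (r * s * z - e' * g) * t = 0.
    have -> : (r * s * z - e' * g) * t = r * (s * (t * z)) - (e' * t) * g by ring.
    by rewrite se -re; ring.
  move=> /treg[r' [r'p r'E]]; have /negP[] : r' * (r * s) \notin p.
    by rewrite !prime_notinM.
  apply/zp; have -> : r' * (r * s) * z = r' * (r * s * z - e' * g) + r' * e' * g by ring.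
  by rewrite r'E add0r; exact: idealMl.
have zreg k c : c * z ^+ k = 0 -> exists r, r \notin p /\ r * c = 0.
  elim: k c => [|k IH] c; first by rewrite mulr1 => ->; exists 1; rewrite mulr0 prime_notin1.
  rewrite exprS mulrA => /IH[r [rp rcz]].
  exists (s * e * r); rewrite !prime_notinM //; split=> //.
  have -> : s * e * r * c = r * c * e * s by ring.
  apply: greg; have -> : r * c * e * g = r * c * (e * g) by ring.
  rewrite -se; have -> : r * c * (s * (t * z)) = r * (c * z) * s * t by ring.
  by rewrite rcz !mul0r.
(* Times [u ^+ n], the equation of dependence has terms [a i * u ^+ i * z ^+ (n - i)]. At [p], [a i]
   is a multiple of [(t * z) ^+ i] with [i >= 1], so each term is a multiple of [t * z ^+ n]. *)
have [r [w [rp rw]]] : exists r w, r \notin p /\ r * z ^+ n = w * (t * z ^+ n).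
  have {1}-> : z ^+ n = - \sum_(1 <= i < n.+1) u ^+ n * (a i * x ^+ (n - i)).
    by rewrite -mulr_sumr exprMn; apply/eqP; rewrite -subr_eq0 opprK -mulrDr xE mulr0.
  rewrite -sumrN big_seq_cond; elim/big_ind: _ => [|y y'|i].
  - by exists 1, 0; rewrite mulr0 mul0r prime_notin1.
  - move=> [r [w [rp rE]]] [r' [w' [r'p r'E]]]; exists (r * r'), (r' * w + r * w').
    rewrite prime_notinM //; split=> //.
    have -> : r * r' * (y + y') = r' * (r * y) + r * (r' * y') by ring.
    by rewrite rE r'E; ring.
  rewrite mem_index_iota andbT => /andP[i0 ilt].
  have [||r [c [rp rc]]] := @local_pow I p g i (a i).
  - exact: local_generatorP lg.
  - by apply: aI; rewrite i0.
  exists (e ^+ i * r), (- c * s ^+ i * t ^+ i.-1 * u ^+ i).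
  rewrite prime_notinM ?prime_notinX //; split=> //.
  have zE : z ^+ n = z ^+ i * (u ^+ (n - i) * x ^+ (n - i)).
    by rewrite -exprMn -exprD subnKC // -ltnS.
  have uE : u ^+ n = u ^+ i * u ^+ (n - i) by rewrite -exprD subnKC // -ltnS.
  have tE : t ^+ i.-1 * t = t ^+ i by rewrite -exprSr prednK.
  have seX : s ^+ i * (t ^+ i * z ^+ i) = e ^+ i * g ^+ i by rewrite -!exprMn se.
  transitivity (- (c * (e ^+ i * g ^+ i) * u ^+ n * x ^+ (n - i))).
    rewrite [RHS](_ : _ = - (e ^+ i * (c * g ^+ i) * u ^+ n * x ^+ (n - i))); last by ring.
    by rewrite -rc; ring.
  by rewrite -seX uE zE -tE; ring.
have [|r' [r'p r'E]] := zreg n (r - w * t); first by rewrite mulrBl rw; ring.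
have /negP[] : r' * (r - w * t) \notin p; last by rewrite r'E ideal0.
apply: prime_notinM => //; apply: contra rp => h.
by rewrite -(subrK (w * t) r); apply: idealD h _; exact: idealMl.
Qed.

(** * Symbolic powers and the primary decomposition *)

Lemma symbolic_powerP p n a :
  a \in symbolic_power p n <-> exists2 u : R, u \notin p & u * a \in ideal_pow p n.
Proof. exact: to_locP. Qed.

Lemma symbolic_power_primary p n : (0 < n)%N -> primary_to p (symbolic_power p n).
Proof.
case: n => // n _.
have sub a : a \in symbolic_power p n.+1 -> a \in p.
  move=> /symbolic_powerP[u up /ideal_pow_sub/prime_mem_mul[]//].
  by rewrite (negPf up).
have powp a : a \in p -> a ^+ n.+1 \in symbolic_power p n.+1.
  move=> ap; apply/symbolic_powerP; exists 1; rewrite ?prime_notin1 // mul1r.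
  exact: ideal_powX.
split=> [|a b|a].
- by apply/negP => /sub; apply/negP/prime_notin1.
- move=> /symbolic_powerP[u up uab].
  have [bp|bp] := boolP (b \in p); first by right; exists n.+1; exact: powp.
  left; apply/symbolic_powerP; exists (u * b); first exact: prime_notinM.
  by rewrite -mulrA (mulrC b).
- split=> [/powp|[k /sub]]; first by exists n.+1.
  by apply: contraTT => ap; exact: prime_notinX.
Qed.

Lemma ex_primary_decomposition (noethR : noetherian R) I :
  (forall p, exists a s, local_generator I p a s) ->
  (forall z p, colon_prime I z p -> exists t, uniformizer p t) ->
  exists n : spec R -> nat,
    (forall p, Ass (quotient_module I) p -> (1 <= n p)%N) /\
    primary_decomposition I (Ass (quotient_module I))
      (fun p => symbolic_power p (n p)).
Proof.
move=> Ilg Iunif.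
(* At an associated prime, [n p] is the exponent with [I R_p = (t ^+ n)]; other primes get the
   default 0. *)
have /choice[n nP] : forall p, exists n, Ass (quotient_module I) p ->
    exists t a s s', [/\ uniformizer p t, exists r, local_generator I p a r,
      s \notin p, s' \notin p & s * a = s' * t ^+ n].
  move=> p; have [/Ass_quotient[z /Iunif[t tunif]]|nA] := pselect (Ass (quotient_module I) p);
    last by exists 0%N => /nA.
  have [a [r lg]] := Ilg p; have [aI rp agen areg] := lg.
  have [u up /areg ur|n [s [s' [sp s'p sa]]]] := uniformizer_krull noethR (a := a) tunif.
    have /negP[] : u * r \notin p by exact: prime_notinM.
    by rewrite ur ideal0.
  by exists n => _; exists t, a, s, s'; split=> //; exists r.
have n0 p : Ass (quotient_module I) p -> (0 < n p)%N.
  move=> pA; have [z /colon_prime_sub Ip] := (Ass_quotient I p).1 pA.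
  have [t [a [s [s' [_ [r [aI _ _ _]] sp s'p sa]]]]] := nP p pA.
  rewrite lt0n; apply: contraNN s'p => /eqP n0.
  by move: sa; rewrite n0 mulr1 => <-; exact/idealMl/Ip.
exists n; split; first exact: n0.
split=> [|p /n0|]; [|exact: symbolic_power_primary|].
  have [s sP] := finite_colon_primes noethR I.
  apply: (@sub_finite_set _ _ [set` s]%classic); last exact: finite_seq.
  by move=> p /Ass_quotient[z zp] /=; exact: sP zp.
apply/seteqP; split=> [x /= xI p pA|x /= xq].
  have [t [a [s [s' [[tp _ _] [r [aI rp agen _]] sp s'p sa]]]]] := nP p pA.
  have [c rx] := agen x xI; apply/symbolic_powerP.
  exists (s * r); first exact: prime_notinM.
  have -> : s * r * x = c * s' * t ^+ n p.
    by rewrite -mulrA rx mulrCA sa mulrA.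
  exact/idealMl/ideal_powX.
(* At [p] the symbolic power agrees with [I], so an element outside [p] would multiply [u * x] into
   [I]. *)
apply: contrapT => /negP/(ex_colon_prime noethR)[u [p zp]].
have pA : Ass (quotient_module I) p by apply/Ass_quotient; exists (u * x).
have [t [a [s [s' [[tp tgen _] [r [aI rp _ _]] sp s'p sa]]]]] := nP p pA.
have /symbolic_powerP[v vp vx] := xq p pA.
have [b /tgen[w [c [wp wb]]]|w [c [wp wvx]]] := @local_pow p p t _ _ _ vx; first by exists w, c.
have /negP[] : s' * w * v \notin p by rewrite !prime_notinM.
apply/zp; have -> : s' * w * v * (u * x) = u * s' * (w * (v * x)) by ring.
rewrite wvx; have -> : u * s' * (c * t ^+ n p) = u * c * (s' * t ^+ n p) by ring.
by rewrite -sa mulrA; exact: idealMl.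
Qed.

End LocallyPrincipal.

(** * The trace map *)

Lemma ex_linear (R : comPzRingType) (U V : lmodType R) (f : U -> V) :
  (forall a x y, f (a *: x + y) = a *: f x + f y) ->
  exists g : {linear U -> V}, forall x, g x = f x.
Proof.
move=> fL; pose g : {linear U -> V} := HB.pack f (GRing.isLinear.Build R U V *:%R f fL).
by exists g.
Qed.

Section Dual.
Context (R : comPzRingType) (M : lmodType R).

Lemma dual_linear (f : dual M) a x y :
  sval f (a *: x + y) = a * sval f x + sval f y :> R.
Proof. by have /asboolP := svalP f; apply. Qed.

Lemma dualZ (f : dual M) a x : sval f (a *: x) = a * sval f x :> R.
Proof.
have f0 : sval f 0 = 0 :> R.
  apply: (@addrI _ (sval f 0 : R)).
  by have := dual_linear f 1 0 0; rewrite scaler0 addr0 mul1r => <-; rewrite addr0.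
by rewrite -[a *: x]addr0 dual_linear f0 addr0.
Qed.

Lemma ex_dual (f : M -> R) : (forall a x y, f (a *: x + y) = a * f x + f y) ->
  exists g : dual M, forall x, sval g x = f x.
Proof.
move=> fL; have fP : (f : M -> R^o) \in @linear_pred R M R^o by exact/asboolP.
by exists (exist (fun f => f \in @linear_pred R M R^o) (f : M -> R^o) fP).
Qed.

Lemma dual_ext (f g : dual M) : (forall x, sval f x = sval g x) -> f = g.
Proof. by move=> fg; apply/val_inj/funext. Qed.

End Dual.

Section Trace.
Context (R : comPzRingType) (I : ideal R).
Notation M := (submodule_type I : lmodType R).
Notation T := (tensor M (dual M)).
Implicit Types (a b c s r : R) (x y : M) (f g : dual M) (t e : T).

Lemma ideal_scaleC x y : sval x *: y = sval y *: x :> M.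
Proof. by apply/val_inj; exact: mulrC. Qed.

(** Both sides are [f] of the product [x y]. *)
Lemma dual_idealC f x y : sval x * sval f y = sval y * sval f x :> R.
Proof. by rewrite -!dualZ ideal_scaleC. Qed.

Lemma ex_trace : exists h : T -> R^o,
  (forall a t e, h (a *: t + e) = a *: h t + h e) /\
  forall x f, h (tens x f) = sval f x.
Proof.
apply: tensor_lift => [a x y f|a x f g]; first exact: dual_linear.
by [].
Qed.

Definition trace : T -> R := sval (cid ex_trace).

Lemma trace_linear a t e : trace (a *: t + e) = a * trace t + trace e.
Proof. by rewrite /trace; case: cid => h [hL _] /=; exact: hL. Qed.

Lemma trace_tens x f : trace (tens x f) = sval f x.
Proof. by rewrite /trace; case: cid => h [_ hE] /=; exact: hE. Qed.

Lemma trace0 : trace 0 = 0.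
Proof.
apply: (@addrI _ (trace 0)).
by have := trace_linear 1 0 0; rewrite scaler0 addr0 mul1r => <-; rewrite addr0.
Qed.

Lemma traceD t e : trace (t + e) = trace t + trace e.
Proof. by rewrite -[t]scale1r trace_linear mul1r scale1r. Qed.

(** On pure tensors, [g(y) x = g(x) y] in [I] and [g(x) f = f(x) g] in the dual; the scalar [g(x)]
    moves across the tensor sign. *)
Lemma trace_scaleC t e : trace e *: t = trace t *: e.
Proof.
move: t; apply: tensor_ind => [|a t t' tE tE'|x f].
- by rewrite trace0 scale0r scaler0.
- by rewrite scalerDr scalerA mulrC -scalerA tE tE' trace_linear scalerDl scalerA.
move: e; apply: tensor_ind => [|a e e' eE eE'|y g].
- by rewrite trace0 scale0r scaler0.
- by rewrite trace_linear scalerDl scalerDr -scalerA eE eE' !scalerA mulrC.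
rewrite !trace_tens -tensZl -!tensZr.
have -> : sval g y *: x = sval g x *: y :> M.
  by apply/val_inj; rewrite /= ![sval g _ *: _]mulrC; exact: dual_idealC.
rewrite tensZl -tensZr; congr tens; apply: dual_ext => z.
have -> : sval (sval g x *: f) z = sval g x * sval f z by [].
have -> : sval (sval f x *: g) z = sval f x * sval g z by [].
rewrite -!dualZ.
have -> : sval f x *: z = sval f z *: x :> M.
  by apply/val_inj; rewrite /= ![sval f _ *: _]mulrC; exact: dual_idealC.
by rewrite dualZ dualZ mulrC.
Qed.

Lemma ex_trace_dual : exists h : dual T, forall t, sval h t = trace t.
Proof. exact/ex_dual/trace_linear. Qed.

Lemma ex_inclusion_dual : exists f : dual M, forall x, sval f x = sval x.
Proof. exact: ex_dual. Qed.

(** As 1 is not in [p], some [f x] is not either. Then [f(x) b = f(b) x] shows that [x] generates,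
    with [f x] as denominator. *)
Lemma trace1_local_generator e p : trace e = 1 -> exists a s, local_generator I p a s.
Proof.
move=> e1; have [x [f fx]] : exists x f, sval f x \notin p.
  apply: contrapT => h; have /negP[] := prime_notin1 p; rewrite -e1.
  move: e {e1}; apply: tensor_ind => [|a t t' tp t'p|x f].
  - by rewrite trace0 ideal0.
  - by rewrite trace_linear; apply: idealD => //; exact: idealMl.
  - by rewrite trace_tens; apply/negPn/negP => fx; apply: h; exists x, f.
exists (sval x), (sval f x); split=> // [|b bI|c cx].
- exact: (valP x).
- exists (sval f (exist _ b bI)); rewrite mulrC [RHS]mulrC.
  exact: (dual_idealC f (exist _ b bI) x).
- rewrite -dualZ; have -> : c *: x = 0 :> M by exact/val_inj.
  by rewrite -(scale0r 0) dualZ mul0r.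
Qed.

(** Since [t = trace t *: e], the module is free on [e] and its dual is free on the trace. *)
Lemma trace1_reflexive e : trace e = 1 -> reflexive_module T.
Proof.
move=> e1; have [h hE] := ex_trace_dual.
have tE t : t = trace t *: e by rewrite -trace_scaleC e1 scale1r.
have surj (F : dual (dual T)) : bidual_map ((sval F h : R) *: e) = F.
  apply: dual_ext => g; rewrite -[LHS]/(sval g ((sval F h : R) *: e)) dualZ.
  have {2}-> : g = sval g e *: h.
    apply: dual_ext => t; rewrite -[RHS]/(sval g e * sval h t) hE.
    by rewrite {1}(tE t) dualZ mulrC.
  by rewrite dualZ mulrC.
exists (fun F => (sval F h : R) *: e) => // t.
by rewrite [RHS]tE -hE.
Qed.

(** A splitting of the map from a free module onto [I] gives a dual basis [g i], [f i]. For [e] the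
    sum of the tensors of [g i] and [f i], [a * trace e] is the sum of [f i (a) * g i], that is
    [a]. *)
Lemma projective_trace1 (noethR : noetherian R) a : a \in I -> nonzerodivisor a ->
  projective M -> exists e, trace e = 1.
Proof.
move=> aI areg proj; have [n [g0 [g0I g0P]]] := fg_ideal noethR I.
pose g i : M := exist (fun x : R^o => x \in I) (g0 i) (g0I i).
have [|G GE] := @ex_linear R 'rV[R]_n M (fun v => \sum_i v ord0 i *: g i).
  move=> b v w; rewrite scaler_sumr -big_split; apply: eq_bigr => i _ /=.
  by rewrite !mxE scalerDl scalerA.
have [|F FE] := @ex_linear R M M id; first by [].
have svalS (v : 'rV[R]_n) :
    sval (\sum_i v ord0 i *: g i : M) = \sum_i v ord0 i * g0 i.
  exact: (raddf_sum (val : M -> R^o)).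
have [x|h hE] := proj _ _ G F.
  have [c xE] := g0P (sval x) (valP x).
  exists (\row_i c i); rewrite GE; apply/val_inj; rewrite /= svalS xE.
  by apply: eq_bigr => i _; rewrite mxE.
have /choice[f fE] : forall i, exists f : dual M, forall x, sval f x = h x ord0 i.
  by move=> i; apply: ex_dual => b x y; rewrite linearP !mxE.
exists (\sum_i tens (g i) (f i)).
have -> : trace (\sum_i tens (g i) (f i)) = \sum_i sval (f i) (g i).
  by rewrite (big_morph trace traceD trace0); apply: eq_bigr => i _; rewrite trace_tens.
apply/eqP; rewrite -subr_eq0 -oppr_eq0 opprB; apply/eqP/areg.
pose x : M := exist (fun x : R^o => x \in I) a aI.
have xE : a = \sum_i sval (f i) x * g0 i.
  transitivity (sval (F x)); first by rewrite FE.
  rewrite -hE GE svalS.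
  by apply: eq_bigr => i _; rewrite fE.
rewrite mulrBr mulr1 mulr_sumr {1}xE -sumrB big1 // => i _.
by rewrite mulrC (dual_idealC (f i) (g i) x) subrr.
Qed.

(** Lifts of [trace e *: F] can be added up over pure tensors. For [x] and [f], if [m] lifts [F x],
    then [f(y) m] lifts [f(y) F(x) = f(x) F(y)]. *)
Lemma trace1_projective e : trace e = 1 -> projective M.
Proof.
move=> e1 A B G F Gsurj.
suff [h [hL hE]] : exists h : M -> A,
    (forall a x y, h (a *: x + y) = a *: h x + h y) /\
    forall x, G (h x) = trace e *: F x.
  have [H HE] := ex_linear hL; exists H => x.
  by rewrite HE hE e1 scale1r.
move: e {e1}; apply: tensor_ind => [|a t t' [h [hL hE]] [h' [h'L h'E]]|x f].
- exists (fun=> 0); split=> [a x y|x]; first by rewrite scaler0 addr0.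
  by rewrite raddf0 trace0 scale0r.
- exists (fun x => a *: h x + h' x); split=> [b x y|x].
    by rewrite hL h'L !scalerDr !scalerA (mulrC a) addrACA.
  by rewrite linearP hE h'E trace_linear scalerDl scalerA.
- have [m mE] := Gsurj (F x); exists (fun y => sval f y *: m); split=> [a y z|y].
    by rewrite dual_linear scalerDl scalerA.
  rewrite linearZ mE trace_tens -!linearZ /=; congr (F _).
  by apply/val_inj; rewrite /= ![sval f _ *: _]mulrC; exact: dual_idealC.
Qed.

Lemma trace1_Pic (noethR : noetherian R) e : trace e = 1 -> in_Pic M.
Proof.
move=> e1; split=> [||p]; [exact: noethR|exact: trace1_projective e1|].
have [a [s [aI sp agen areg]]] := trace1_local_generator p e1.
pose x : M := exist (fun x : R^o => x \in I) a aI.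
(* This fraction is a basis of the localized ideal; the coordinate along it is the isomorphism. *)
pose A : local_module p M := frac x (den1 _).
have AE r (t : {s | s \in prime_compl p}) :
  loc_frac r t *: A = frac (r *: x) (denM t (den1 _)) by exact: loc_scaleE.
have Ainj (w : local_ring p) : w *: A = 0 -> w = 0.
  have [r [t ->]] := loc_fracP w; rewrite AE => /frac_eq[u up].
  rewrite scaler0 subr0 scale1r => /(congr1 sval) ur.
  have {ur}/areg urs : u * r * a = 0 by rewrite -mulrA.
  apply/loc_frac_eq0; exists (s * u); first exact: prime_notinM.
  by rewrite -urs; ring.
have /choice[g gK] : forall w : local_module p M, exists r : local_ring p, w = r *: A.
  move=> w; have [b [t ->]] := fracP w.
  have [c sb] := agen (sval b) (valP b).
  have sS : s \in prime_compl p by [].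
  exists (loc_frac c (denM t (exist (fun s => s \in prime_compl p) s sS))); rewrite AE.
  apply: frac_cong; apply/val_inj => /=.
  rewrite -[LHS]/(sval t * s * 1 * sval b) -[RHS]/(sval t * (c * a)) -sb; ring.
have gE (r : local_ring p) : g (r *: A) = r.
  by apply/eqP; rewrite -subr_eq0; apply/eqP/Ainj; rewrite scalerBl -gK subrr.
have [|G GE] := @ex_linear (local_ring p) (local_module p M) (local_ring p)^o g.
  by move=> r v w; rewrite {1}(gK v) {1}(gK w) scalerA -scalerDl gE.
exists G; exists (fun r : local_ring p => r *: A) => [w|r]; rewrite GE; [exact/esym/gK|exact: gE].
Qed.

End Trace.

(** * Reflexivity of the tensor product *)

Section ReflexiveTensor.
Context (R : comPzRingType) (I : ideal R) (a0 : R).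
Hypotheses (noethR : noetherian R) (a0I : a0 \in I) (a0_reg : nonzerodivisor a0).
Notation M := (submodule_type I : lmodType R).
Notation T := (tensor M (dual M)).
Implicit Types (a b c s z : R) (x y : M) (f g : dual M) (t e : T) (p q : spec R).

Let x0 : M := exist (fun x : R^o => x \in I) a0 a0I.

(** Evaluation at [a0] identifies the dual with an ideal of [R]: by [dual_eval0] and regularity of
    [a0], it is injective. *)
Let eval0 f : R := sval f x0.

Lemma dual_eval0 f x : a0 * sval f x = sval x * eval0 f.
Proof. exact: (dual_idealC f x0 x). Qed.

Lemma eval0_linear a f g : eval0 (a *: f + g) = a * eval0 f + eval0 g.
Proof. by []. Qed.

Lemma ex_dual_generators : exists n (f : 'I_n -> dual M),
  forall g, exists c : 'I_n -> R, eval0 g = \sum_j c j * eval0 (f j).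
Proof.
have [||N NP] := @ex_ideal _ (fun c => exists f, eval0 f = c).
- by exists 0.
- by move=> a _ _ [f <-] [g <-]; exists (a *: f + g).
have [n [c [cN cgen]]] := fg_ideal noethR N.
have /choice[f fE] : forall j, exists f, eval0 f = c j by move=> j; apply/NP.
exists n, f => g; have [|d ->] := cgen (eval0 g); first by apply/NP; exists g.
by exists d; apply: eq_bigr => j _; rewrite fE.
Qed.

(** Trace zero forces [a0 *: t = 0], so every functional vanishes on [t], and reflexivity separates
    points. *)
Lemma reflexive_trace_inj t : reflexive_module T -> trace t = 0 -> t = 0.
Proof.
move=> [h hK _] t0; have [i iE] := ex_inclusion_dual I.
rewrite -[t]hK -[RHS]hK; congr h; apply: dual_ext => g.
have g0 : sval g 0 = 0 :> R by rewrite -(scale0r 0) dualZ mul0r.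
rewrite [RHS]g0; apply: a0_reg.
rewrite -[LHS](dualZ g a0 t); suff -> : a0 *: t = 0 by [].
have <- : trace (tens x0 i) = a0 by rewrite trace_tens iE.
by rewrite trace_scaleC t0 scale0r.
Qed.

(* If [k] relates [f i] to the other generators, then [k] and the coefficients of
   the relation lie in [p], so [z] multiplies them into [I] and the relation
   yields an element of [T] of trace zero. Its image under
   [b (x) g |-> b * (coordinate of s g along f i)] is [z * s * k]. *)
Lemma trace_inj_colon p z s n (f : 'I_n -> dual M) (A : {set 'I_n}) i (L : ideal R) :
  (forall t, trace t = 0 -> t = 0) -> colon_prime I z p ->
  (forall g, exists c : 'I_n -> R, s * eval0 g = \sum_(j in A) c j * eval0 (f j)) ->
  (forall c : 'I_n -> R, \sum_(j in A) c j * eval0 (f j) = 0 ->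
     forall j, j \in A -> c j \in p) ->
  i \in A ->
  (forall k : R, k \in L <-> exists c : 'I_n -> R,
     k * eval0 (f i) = \sum_(j in A :\ i) c j * eval0 (f j)) ->
  forall k : R, k \in L -> z * s * k \in ideal_mul I L.
Proof.
move=> tr_inj zp gen rel iA LP k kL.
pose P g c := exists d : 'I_n -> R,
  s * eval0 g = c * eval0 (f i) + \sum_(j in A :\ i) d j * eval0 (f j).
have /choice[c cP] : forall g, exists c, P g c.
  move=> g; have [d gd] := gen g; exists (d i), d.
  by rewrite gd (big_setD1 i).
have Punique g c1 c2 : P g c1 -> P g c2 -> c1 - c2 \in L.
  move=> [d1 E1] [d2 E2]; apply/LP; exists (fun j => d2 j - d1 j).
  have -> : \sum_(j in A :\ i) (d2 j - d1 j) * eval0 (f j) =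
      \sum_(j in A :\ i) d2 j * eval0 (f j) - \sum_(j in A :\ i) d1 j * eval0 (f j).
    by rewrite -sumrB; apply: eq_bigr => j _; rewrite mulrBl.
  apply/eqP; rewrite -subr_eq0; apply/eqP.
  transitivity ((s * eval0 g) - (s * eval0 g)); last by rewrite subrr.
  by rewrite {1}E1 E2; ring.
have Plinear a g g' d d' : P g d -> P g' d' -> P (a *: g + g') (a * d + d').
  move=> [e E] [e' E']; exists (fun j => a * e j + e' j).
  have -> : \sum_(j in A :\ i) (a * e j + e' j) * eval0 (f j) =
      a * \sum_(j in A :\ i) e j * eval0 (f j) + \sum_(j in A :\ i) e' j * eval0 (f j).
    by rewrite mulr_sumr -big_split; apply: eq_bigr => j _ /=; rewrite mulrDl mulrA.
  rewrite eval0_linear mulrDr mulrCA E E'; ring.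
(* The coordinate along [f i] is defined only modulo [L], so its product with an element of [I]
   makes sense modulo [I L]. *)
pose Q : lmodType R := quotient_module (ideal_mul I L).
pose pr (b : R) : Q := quotient_proj (ideal_mul I L) (b : R^o).
have prE b b' : b - b' \in ideal_mul I L -> pr b = pr b'.
  by move=> bb'; exact/quotient_proj_eq.
have prL a b b' : a *: pr b + pr b' = pr (a * b + b').
  transitivity (quotient_scale a (pr b) + pr b') => //.
  by rewrite quotient_scaleE -quotient_projD.
have pr0 b : pr b = 0 -> b \in ideal_mul I L.
  move=> b0; have : pr b = pr 0.
    have := prL 1 0 0; rewrite mulr0 addr0 scale1r => h.
    by rewrite b0; apply: (@addrI _ (pr 0)); rewrite addr0 h.
  by move=> /quotient_proj_eq; rewrite subr0.
pose B (x : M) (g : dual M) : Q := pr (sval x * c g).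
have BP x g d : P g d -> B x g = pr (sval x * d).
  move=> gd; apply: prE; rewrite -mulrBr; apply: ideal_mul_mem; first exact: (valP x).
  exact: Punique (cP g) gd.
have [a x y g|a x g g'|h [hL hE]] := @tensor_lift R M (dual M) Q B.
- by rewrite prL; congr pr; rewrite -[sval (a *: x + y)]/(a * sval x + sval y); ring.
- rewrite (BP _ _ (a * c g + c g')) ?prL; last exact: Plinear.
  by congr pr; ring.
have [d kd] := (LP k).1 kL.
pose d' j := if j == i then - k else d j.
have d'E : \sum_(j in A) d' j * eval0 (f j) = 0.
  rewrite (big_setD1 i) //= {1}/d' eqxx mulNr kd addrC; apply/eqP; rewrite subr_eq0.
  apply/eqP/eq_bigr => j; rewrite !inE => /andP[ji _].
  by rewrite /d' (negPf ji).
have /choice[m mE] : forall j, exists x : M, j \in A -> sval x = z * d' j.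
  move=> j; have [jA|_] := boolP (j \in A); last by exists 0.
  have zd : z * d' j \in I by rewrite mulrC; apply/zp/rel.
  by exists (exist (fun x : R^o => x \in I) _ zd).
pose t := \sum_(j in A) tens (m j) (f j).
have t0 : t = 0.
  apply: tr_inj; apply: a0_reg.
  rewrite (big_morph (@trace R I) (@traceD R I) (trace0 I)) mulr_sumr.
  transitivity (z * \sum_(j in A) d' j * eval0 (f j)); last by rewrite d'E mulr0.
  rewrite mulr_sumr; apply: eq_bigr => j jA.
  by rewrite trace_tens dual_eval0 mE // mulrA.
have hD t1 t2 : h (t1 + t2) = h t1 + h t2 by rewrite -[t1]scale1r hL !scale1r.
have h0 : h 0 = 0 by apply: (@addrI _ (h 0)); rewrite -hD !addr0.
have : h t = pr (- (z * s * k)).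
  rewrite (big_morph h hD h0) (big_setD1 i) //= big1 => [|j].
    rewrite addr0 hE (BP _ _ s); last first.
      by exists (fun=> 0); rewrite big1 ?addr0 // => j _; rewrite mul0r.
    by rewrite mE // /d' eqxx; congr pr; ring.
  rewrite !inE => /andP[ji jA]; rewrite hE (BP _ _ 0).
    by rewrite mulr0; apply: (@addrI _ (pr 0)); have := prL 1 0 0;
      rewrite mulr0 !addr0 scale1r.
  exists (fun l => if l == j then s else 0).
  rewrite mul0r add0r (bigD1 j) /=; last by rewrite !inE ji.
  rewrite eqxx big1 ?addr0 // => l /andP[_ /negPf ->]; exact: mul0r.
rewrite t0 h0 => /esym/pr0 h1; rewrite -[_ * k]opprK -mulN1r; exact: idealMl.
Qed.

(* A minimal family of [n >= 2] generators of the dual at [p] would make [z]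
   integral over [I] at [p]. *)
Lemma trace_inj_dual_principal p z :
  (forall t, trace t = 0 -> t = 0) -> integrally_closed I -> colon_prime I z p ->
  exists f s, s \notin p /\ forall g, exists c, s * eval0 g = c * eval0 f.
Proof.
move=> tr_inj Iic zp.
have [n [f fgen]] := ex_dual_generators.
pose gens s (A : {set 'I_n}) := forall g, exists c : 'I_n -> R,
  s * eval0 g = \sum_(j in A) c j * eval0 (f j).
have [|A /minsetP[/asboolP[s [sp sA]] Amin]] :=
    @ex_minset _ (fun A => `[< exists s, s \notin p /\ gens s A >]).
  exists [set: 'I_n]%SET; apply/asboolP; exists 1; split=> [|g]; first exact: prime_notin1.
  have [c cE] := fgen g; exists c; rewrite mul1r cE.
  by apply: eq_bigl => j; rewrite inE.
(* A coefficient outside [p] would allow [f j] to be eliminated at [p], against the minimality of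
   [A]. *)
have rel (c : 'I_n -> R) : \sum_(j in A) c j * eval0 (f j) = 0 ->
    forall j, j \in A -> c j \in p.
  move=> c0 j jA; apply/negPn/negP => cj.
  suff : A :\ j = A by move=> h; move: jA; rewrite -h !inE eqxx.
  apply: Amin; last exact: subD1set.
  apply/asboolP; exists (s * c j); split; first exact: prime_notinM.
  move=> g; have [d gd] := sA g; exists (fun l => c j * d l - d j * c l).
  have -> : \sum_(l in A :\ j) (c j * d l - d j * c l) * eval0 (f l) =
      c j * (\sum_(l in A :\ j) d l * eval0 (f l)) -
      d j * (\sum_(l in A :\ j) c l * eval0 (f l)).
    rewrite !mulr_sumr -sumrB; apply: eq_bigr => l _; ring.
  move: c0 gd; rewrite !(big_setD1 j jA) /=.
  set X := \sum_(_ in _) _; set Y := \sum_(_ in _) _ => cX gY.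
  have -> : X = - (c j * eval0 (f j)).
    by apply/eqP; rewrite -addr_eq0 addrC cX.
  have -> : Y = s * eval0 g - d j * eval0 (f j) by rewrite gY; ring.
  ring.
have [incl inclE] := ex_inclusion_dual I.
have eval_incl : eval0 incl = a0 by rewrite /eval0 inclE.
(* What kills all generators kills [s * a0], since [a0] is the value of the inclusion. *)
have s_reg c : (forall j, j \in A -> c * eval0 (f j) = 0) -> c * s = 0.
  move=> cA; have [d sd] := sA incl; rewrite mulrC; apply: a0_reg; rewrite mulrA -eval_incl (mulrC _ s) sd mulr_suml.
  by rewrite big1 // => j jA; rewrite -mulrA (mulrC _ c) cA ?mulr0.
have [i iA] : exists i, i \in A.
  apply/set0Pn; apply/negP => /eqP A0.
  have /negP[] := sp; suff -> : s = 0 by exact: ideal0.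
  by rewrite -[s]mul1r; apply: s_reg => j; rewrite A0 inE.
have [[j jA ji]|Ai] := pselect (exists2 j, j \in A & j != i); last first.
  exists (f i), s; split=> // g; have [c gc] := sA g; exists (c i).
  rewrite gc (big_setD1 i) //= big1 ?addr0 // => j; rewrite !inE => /andP[ji jA].
  by case: Ai; exists j.
exfalso; have [J [IJ zJ JP]] := ex_adjoin I (z * s).
have kill k : k \in A -> exists n h, h \in ideal_mul I (ideal_pow J n) /\
    forall l, l \in A -> l != k -> ((z * s) ^+ n.+1 + h) * eval0 (f l) = 0.
  move=> kA; have [||L LP] := @ex_ideal _ (fun b => exists c : 'I_n -> R,
     b * eval0 (f k) = \sum_(j in A :\ k) c j * eval0 (f j)).
  - by exists (fun=> 0); rewrite mul0r big1 // => l _; rewrite mul0r.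
  - move=> b x y [c xc] [d yd]; exists (fun j => b * c j + d j).
    rewrite mulrDl -mulrA xc yd mulr_sumr -big_split /=.
    by apply: eq_bigr => l _; rewrite mulrDl mulrA.
  have [m [h [hI hL]]] := determinant_trick noethR IJ zJ
    (trace_inj_colon tr_inj zp sA rel kA LP).
  exists m, h; split=> // l lA lk; apply: hL; apply/LP.
  (* [eval0 (f l)] is in [L]: its product with [eval0 (f k)], read the other way, is a multiple of
     [eval0 (f l)]. *)
  exists (fun l' => if l' == l then eval0 (f k) else 0).
  rewrite (bigD1 l) /=; last by rewrite !inE lk.
  rewrite eqxx big1 => [|l' /andP[_ /negPf ->]]; last exact: mul0r.
  by rewrite addr0 mulrC.
(* The expression for [i] kills all generators but possibly [f i], which the one for [j] kills;
   their product kills them all. *)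
have [m [h [hI hA]]] := kill i iA; have [m' [h' [h'I h'A]]] := kill j jA.
have [e eI eE] := adjoin_monic_mul IJ zJ hI h'I.
have /s_reg es0 l : l \in A -> ((z * s) ^+ (m + m').+2 + e) * eval0 (f l) = 0.
  move=> lA; rewrite -eE; have [li|li] := eqVneq l i.
    by rewrite -mulrA h'A ?mulr0 // li eq_sym.
  by rewrite mulrAC hA ?mul0r.
have /negP[] : s * s \notin p by exact: prime_notinM.
apply/zp; have -> : s * s * z = s * (z * s) by ring.
apply: (integral_criterion (J := J) (h := s * e) (n := (m + m').+1)) => //.
  exact: idealMl.
by rewrite -mulrDr mulrC.
Qed.

Lemma reflexive_trace1 : (0 < height I)%E -> serre_condition 2 R ->
  integrally_closed I -> reflexive_module T -> exists t, trace t = 1.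
Proof.
move=> hI S2 Iic Trefl; have tr_inj t := @reflexive_trace_inj t Trefl.
have [i iE] := ex_inclusion_dual I; have [tr trE] := ex_trace_dual I.
pose X : T := tens x0 i; have X0 : trace X = a0 by rewrite trace_tens iE.
have tX t : a0 *: t = trace t *: X by rewrite -X0 trace_scaleC.
have div (G : dual T) : exists c, a0 * c = sval G X.
  apply: contrapT => nG; set w : R := sval G X in nG.
  have [|u [p yp]] := ex_colon_prime noethR (I := span [set (a0 : R^o)]%classic) (z := w).
    by apply/negP => /mem_span1[c wc]; apply: nG; exists c; rewrite mulrC.
  (* For [b] in [I], [tX] gives [b * w = a0 * G(y (x) i)], a multiple of [a0]. *)
  have Ip : {subset I <= p}.
    move=> b bI; apply/yp; rewrite mulrCA; apply/idealMl/mem_span1.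
    pose y : M := exist (fun x : R^o => x \in I) b bI.
    exists (sval G (tens y i)).
    have -> : b = trace (tens y i) by rewrite trace_tens iE.
    by rewrite -[LHS]dualZ -tX dualZ mulrC.
  have [z zp] : exists z, colon_prime I z p.
    (* Positive height puts a prime [q'] strictly below [q], and (S2) excludes a second strict
       inclusion up to [p]. *)
    apply: colon_prime_minimal => // q Iq qp.
    have [q' q'q qq'] := height_gt0_prime hI Iq.
    exact: (serre_colon_prime S2 a0_reg yp q'q qq' qp).
  have [f [s [sp fgen]]] := trace_inj_dual_principal tr_inj Iic zp.
  (* By [wf], [g] plays the role of [(w / a0) f]. As [f] generates the dual at [p], [w / a0] is then
     a fraction [c / s] there. *)
  have [g gE] : exists g : dual M, forall x, sval g x = sval G (tens x f).
    by apply: ex_dual => b x y; rewrite tensDl tensZl dual_linear.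
  have wf : w * eval0 f = a0 * eval0 g.
    have -> : a0 * eval0 g = sval G (a0 *: tens x0 f) by rewrite dualZ /eval0 gE.
    by rewrite tX trace_tens dualZ mulrC.
  have [c sc] := fgen g; have [d sd] := fgen i.
  have sreg b : b * eval0 f = 0 -> s * b = 0.
    move=> bf; apply: a0_reg.
    have -> : a0 * (s * b) = s * eval0 i * b by rewrite /eval0 iE /=; ring.
    by rewrite sd -mulrA (mulrC _ b) bf mulr0.
  have ssw : s * (s * w - a0 * c) = 0.
    apply: sreg; rewrite mulrBl -mulrA wf.
    have -> : s * (a0 * eval0 g) = a0 * (s * eval0 g) by ring.
    by rewrite sc; ring.
  have /negP[] : s * s \notin p by exact: prime_notinM.
  apply/yp/mem_span1; exists (s * u * c); apply/eqP; rewrite -subr_eq0.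
  have -> : s * s * (u * w) - s * u * c * a0 = u * (s * (s * w - a0 * c)) by ring.
  by rewrite ssw mulr0.
have /choice[F0 F0E] := div.
have a0_inj b c : a0 * b = a0 * c -> b = c.
  move=> /eqP; rewrite -subr_eq0 -mulrBr => /eqP/a0_reg/eqP.
  by rewrite subr_eq0 => /eqP.
(* Sending [G] to [G(X) / a0] is a functional on the dual of [T]. Reflexivity makes it evaluation at
   an element, whose trace is [trace X / a0 = 1]. *)
have [a G H|F FE] := @ex_dual R (dual T) F0.
  apply: a0_inj; rewrite mulrDr mulrCA !F0E.
  by [].
have [h _ hK] := Trefl; exists (h F).
rewrite -trE -[LHS]/(sval (bidual_map (h F)) tr) hK FE.
by apply: a0_inj; rewrite F0E trE X0 mulr1.
Qed.

End ReflexiveTensor.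

(** * The three equivalent conditions and the decomposition *)

Theorem theorem3p3 (R : comPzRingType) (I : ideal R)
    (noethR : noetherian R) (heightI : (0 < height I)%E)
    (S2 : serre_condition 2 R) :
  let M : lmodType R := submodule_type I in
  let RI : lmodType R := quotient_module I in
  let i := integrally_closed I /\ in_Pic M in
  let ii := (forall p, Ass RI p -> discrete_valuation_ring (local_ring p)) /\
    in_Pic M in
  let iii := integrally_closed I /\ reflexive_module (tensor M (dual M)) in
  [/\ i <-> ii, ii <-> iii &
      (i \/ ii \/ iii ->
        exists n : spec R -> nat,
          (forall p, Ass RI p -> (1 <= n p)%N) /\
          primary_decomposition I (Ass RI) (fun p => symbolic_power p (n p)))].
Proof.
move=> M RI i ii iii.
have [a aI areg] := ex_nonzerodivisor_height_gt0 S2 noethR heightI.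
have PicI : in_Pic M <-> exists e : tensor M (dual M), trace e = 1.
  split=> [[_ Mproj _]|[e e1]]; last exact: trace1_Pic e1.
  exact: projective_trace1 aI areg Mproj.
have lg : in_Pic M -> forall p, exists a s, local_generator I p a s.
  by move=> /PicI[e e1] p; exact: trace1_local_generator e1.
have unif_ii : ii -> forall z p, colon_prime I z p -> exists t, uniformizer p t.
  by move=> [dvr _] z p zp; apply/dvr_uniformizer/dvr/Ass_quotient; exists z.
have i_ii : i <-> ii.
  split=> [[Iic MPic]|hii]; last first.
    split; last exact: hii.2.
    exact: uniformizer_integrally_closed (lg hii.2) (unif_ii hii).
  split=> // p /Ass_quotient[z zp]; have [b [s bs]] := lg MPic p.
  have [t tunif] := local_generator_uniformizer noethR Iic bs zp.
  exact: uniformizer_dvr tunif.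
have ii_iii : ii <-> iii.
  split=> [hii|[Iic Mrefl]].
    split; first exact: (i_ii.2 hii).1.
    by have /PicI[e e1] := hii.2; exact: trace1_reflexive e1.
  by apply/i_ii; split=> //; apply/PicI; exact: (reflexive_trace1 noethR aI areg).
split=> // hyp.
have hii : ii by case: hyp => [/i_ii|[|/ii_iii]].
exact: ex_primary_decomposition (lg hii.2) (unif_ii hii).
Qed.
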